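(* Let $N\ge 1$ and let $f:\mathbb{B}^N\to\mathbb{B}^N$ be a parabolic holomorphic self-map of the unit ball $\mathbb{B}^N\subset\mathbb{C}^N$ with Denjoy-Wolff point $p=(1,0)\in\mathbb{C}\times\mathbb{C}^{N-1}$. Let $Z_0\in\mathbb{B}^N$ and let $Z_n=f_n(Z_0)$, $n\ge 1$, be the corresponding sequence of forward iterates. If the sequence $\{Z_n\}_{n=1}^{\infty}$ (which converges to $p$) is restricted, then it has zero step, i.e. $d_{\mathbb{B}^N}(Z_n,Z_{n+1})\to 0$ as $n\to\infty$.
   Context: Notation: $\mathbb{B}^N=\{Z\in\mathbb{C}^N:\|Z\|<1\}$, where $\|\cdot\|$ is the Euclidean norm and $\langle\cdot,\cdot\rangle$ the standard Hermitian inner product on $\mathbb{C}^N$ (linear in the first argument). $f_n=f^{\circ n}$ denotes the $n$-th iterate of $f$. Pseudo-hyperbolic distance on $\mathbb{B}^N$: for $Z,W\in\mathbb{B}^N$, $$d_{\mathbb{B}^N}(Z,W)=\left(1-\frac{(1-\|Z\|^2)(1-\|W\|^2)}{|1-\langle Z,W\rangle|^2}\right)^{1/2}.$$ Denjoy-Wolff point and multiplier: if $f:\mathbb{B}^N\to\mathbb{B}^N$ is holomorphic without fixed points in $\mathbb{B}^N$, then (Hervé, MacCluer) the iterates $f_n$ converge uniformly on compact subsets of $\mathbb{B}^N$ to a constant map $Z\mapsto p$ with a unique $p\in\partial\mathbb{B}^N$, called the Denjoy-Wolff point of $f$, and the number $$c=\liminf_{Z\to p}\frac{1-\|f(Z)\|}{1-\|Z\|}$$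 lies in $(0,1]$; it is called the multiplier (boundary dilatation coefficient) of $f$ at $p$. Such a map $f$ (holomorphic, without fixed points in $\mathbb{B}^N$) is called parabolic if $c=1$. Special and restricted sequences: let $X\in\partial\mathbb{B}^N$ and let $Z_n\in\mathbb{B}^N$ with $Z_n\to X$. The sequence is called special if $$\lim_{n\to\infty}\frac{\|Z_n-\langle Z_n,X\rangle X\|^2}{1-\|\langle Z_n,X\rangle X\|^2}=0.$$ It is called restricted if it is special and its orthogonal projection $\langle Z_n,X\rangle X$ converges to $X$ non-tangentially, i.e. the points $\langle Z_n,X\rangle$ of the unit disk converge to $1$ within a Stolz angle: there is $M>1$ such that $|1-\langle Z_n,X\rangle|<M(1-|\langle Z_n,X\rangle|)$ for all sufficiently large $n$. In the claim these notions are used with $X=p=(1,0)$. Zero step: a sequence of forward iterates $\{Z_n\}$ is called zero-step if $\lim_{n\to\infty}d_{\mathbb{B}^N}(Z_n,Z_{n+1})=0$. *)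

(* Defs.v *)
From HB Require Import structures.
From mathcomp Require Import all_boot all_order all_algebra.
From mathcomp Require Import complex.
From mathcomp Require Import all_classical all_reals all_analysis.
Set Implicit Arguments.
Unset Strict Implicit.
Unset Printing Implicit Defensive.
Import Order.TTheory GRing.Theory Num.Theory.
Import numFieldNormedType.Exports.
Local Open Scope classical_set_scope.
Local Open Scope ring_scope.
Local Open Scope complex_scope.

(* Same recipe as [numFieldNormedType]: R[i] gets the topology and norm that  *)
(* MathComp-Analysis puts on R[i]^o, which the library only registers for     *)
(* abstract fields, so that R[i] and 'rV[R[i]]_n are normed modules over R[i].*)
#[export, non_forgetful_inheritance]
HB.instance Definition _ (R : realType) := GRing.ComAlgebra.copy R[i] R[i]^o.
#[export, non_forgetful_inheritance]
HB.instance Definition _ (R : realType) := Vector.copy R[i] R[i]^o.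
#[export, non_forgetful_inheritance]
HB.instance Definition _ (R : realType) := NormedModule.copy R[i] R[i]^o.
#[export, non_forgetful_inheritance]
HB.instance Definition _ (R : realType) := Num.ClosedField.on R[i].

(* C^N is 'rV[R[i]]_n.+1 with N = n.+1, so that N >= 1.  The library norm on  *)
(* matrices is the max norm: it gives the usual topology (used for limits,    *)
(* compactness and differentiability), but the Euclidean norm is defined here.*)
(* The library modulus `|z| is R[i]-valued; [Normc.normc z] : R is its value. *)

Local Notation modulus := ComplexField.Normc.normc.

Definition hdot (R : realType) (n : nat) (Z W : 'rV[R[i]]_n.+1) : R[i] :=
  \sum_(j < n.+1) Z ord0 j * conjc (W ord0 j).

Definition enorm (R : realType) (n : nat) (Z : 'rV[R[i]]_n.+1) : R :=
  Num.sqrt (\sum_(j < n.+1) modulus (Z ord0 j) ^+ 2).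

Definition unit_ball (R : realType) (n : nat) : set 'rV[R[i]]_n.+1 :=
  [set Z | enorm Z < 1].

Definition unit_sphere (R : realType) (n : nat) : set 'rV[R[i]]_n.+1 :=
  [set Z | enorm Z = 1].

Definition e1 (R : realType) (n : nat) : 'rV[R[i]]_n.+1 :=
  delta_mx ord0 ord0.

Definition pseudo_hyp_dist (R : realType) (n : nat)
    (Z W : 'rV[R[i]]_n.+1) : R :=
  Num.sqrt (1 - (1 - enorm Z ^+ 2) * (1 - enorm W ^+ 2)
                / modulus (1 - hdot Z W) ^+ 2).

(* Self-maps of the ball are represented by total functions on C^N whose      *)
(* values outside the ball are irrelevant.  [differentiable] is over the      *)
(* scalar field R[i], i.e. complex Frechet differentiability; the ball is     *)
(* open, so this is holomorphy on the ball.                                   *)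
Definition holomorphic_self_map (R : realType) (n : nat)
    (f : 'rV[R[i]]_n.+1 -> 'rV[R[i]]_n.+1) : Prop :=
  (forall Z, unit_ball Z -> unit_ball (f Z)) /\
  (forall Z : 'rV[R[i]]_n.+1, unit_ball Z -> differentiable f Z).

Definition no_fixed_point (R : realType) (n : nat)
    (f : 'rV[R[i]]_n.+1 -> 'rV[R[i]]_n.+1) : Prop :=
  forall Z, unit_ball Z -> f Z <> Z.

Definition denjoy_wolff_point (R : realType) (n : nat)
    (f : 'rV[R[i]]_n.+1 -> 'rV[R[i]]_n.+1) (p : 'rV[R[i]]_n.+1) : Prop :=
  unit_sphere p /\
  forall K : set 'rV[R[i]]_n.+1, compact K -> K `<=` @unit_ball R n ->
    {uniform K, (fun k : nat => iter k f) @ \oo --> (fun=> p)}.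

Definition multiplier (R : realType) (n : nat)
    (f : 'rV[R[i]]_n.+1 -> 'rV[R[i]]_n.+1) (p : 'rV[R[i]]_n.+1) : \bar R :=
  limf_einf (fun Z => ((1 - enorm (f Z)) / (1 - enorm Z))%:E)
            (within (@unit_ball R n) (nbhs p)).

Definition parabolic_with_dw_point (R : realType) (n : nat)
    (f : 'rV[R[i]]_n.+1 -> 'rV[R[i]]_n.+1) (p : 'rV[R[i]]_n.+1) : Prop :=
  [/\ holomorphic_self_map f, no_fixed_point f,
      denjoy_wolff_point f p & multiplier f p = 1%:E].

Definition special_seq (R : realType) (n : nat)
    (X : 'rV[R[i]]_n.+1) (Z : nat -> 'rV[R[i]]_n.+1) : Prop :=
  [/\ unit_sphere X, forall k, unit_ball (Z k), Z @ \oo --> X &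
      (fun k => enorm (Z k - hdot (Z k) X *: X) ^+ 2
                / (1 - enorm (hdot (Z k) X *: X) ^+ 2)) @ \oo --> (0 : R)].

Definition restricted_seq (R : realType) (n : nat)
    (X : 'rV[R[i]]_n.+1) (Z : nat -> 'rV[R[i]]_n.+1) : Prop :=
  [/\ special_seq X Z,
      (fun k => hdot (Z k) X) @ \oo --> (1 : R[i]) &
      exists2 M : R, 1 < M &
        \forall k \near \oo,
          modulus (1 - hdot (Z k) X) < M * (1 - modulus (hdot (Z k) X))].

Definition zero_step (R : realType) (n : nat)
    (Z : nat -> 'rV[R[i]]_n.+1) : Prop :=
  (fun k => pseudo_hyp_dist (Z k) (Z k.+1)) @ \oo --> (0 : R).

(* Main.v *)
Require Import Defs.
From mathcomp Require Import all_boot all_order all_algebra.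
From mathcomp Require Import complex.
From mathcomp Require Import all_classical all_reals all_analysis.
From mathcomp Require Import ring lra.
Set Implicit Arguments.
Unset Strict Implicit.
Unset Printing Implicit Defensive.
Import Order.TTheory GRing.Theory Num.Theory.
Import numFieldNormedType.Exports.
Local Open Scope classical_set_scope.
Local Open Scope ring_scope.
Local Open Scope complex_scope.

(* Let [z_k] be the first coordinate of [Z_k], [rho_k = 1 - |z_k|^2], and let
   [g z] be the first coordinate of [f (z, 0)], a holomorphic self-map of the
   disc.  Applying Schwarz-Pick to [f] on the disc through [Z_k] and [(z_k, 0)],
   specialness gives [|g z_k - z_(k+1)| = o(rho_(k+1))].  As [rho_k -> 0],
   infinitely often [rho_(k+1) <= rho_k]; Schwarz-Pick for [g] based at those
   [z_k] yields Julia's inequality with constant 1, that is, [Re F >= 0] for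
   [F = (1 + g) / (1 - g) - (1 + z) / (1 - z)].  Multiplier 1 on the radius
   produces points [b] at which [Re F] is arbitrarily small relative to
   [Re ((1 + b) / (1 - b))], and Harnack's inequality based at [b] gives
   [F z = o(1 / |1 - z|)] in Stolz angles, hence [|g z_k - z_k| = o(rho_k)].
   So [|z_(k+1) - z_k| = o(rho_k)], and with specialness the step tends to 0.
   The Schwarz lemma for complex differentiable functions rests on Goursat's
   theorem for rectangles in logarithmic polar coordinates, where integrals are
   replaced by differences of antiderivatives. *)

Local Notation modulus := ComplexField.Normc.normc.
Local Notation Re := complex.Re.
Local Notation Im := complex.Im.

(** * Goursat's theorem on rectangles *)

Section RealGoursat.
Variable R : realType.
Implicit Types (P Q A B : R -> R -> R).

(** The only place where an integral occurs. Continuity is asked on the closed segment and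
    differentiability is obtained in its interior, which is why later rectangles come with a margin
    around them. *)
Lemma antiderivative (f : R -> R) (a b : R) :
  (forall x, a <= x <= b -> {for x, continuous f}) ->
  exists F : R -> R, forall x, a < x < b -> is_derive x 1 F (f x).
Proof.
move=> cf; exists (fun x => \int[lebesgue_measure]_(t in `[a, x]) (f t))%R.
move=> x /andP[ax xb].
have fi : lebesgue_measure.-integrable `[a, b] (EFin \o f).
  apply: continuous_compact_integrable; first exact: segment_compact.
  by apply: continuous_in_subspaceT => y /set_mem/= /cf.
have cfx : {for x, continuous f} by apply: cf; rewrite !ltW.
have [d e] := continuous_FTC1_closed xb fi ax cfx.
by apply: (DeriveDef d); rewrite -derive1E.
Qed.

Lemma mean_value (F f : R -> R) (a0 b0 a b : R) : a0 < a -> b < b0 -> a <= b ->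
  (forall x, a0 < x < b0 -> is_derive x 1 F (f x)) ->
  exists2 x, a <= x <= b & F b - F a = f x * (b - a).
Proof.
move=> a0a bb0 ab dF.
have {}dF x : a <= x <= b -> is_derive x 1 F (f x).
  by move=> /andP[ax xb]; apply: dF; rewrite (lt_le_trans a0a)// (le_lt_trans xb).
have [||x xab ->] := @MVT_segment R F f a b ab.
- by move=> x; rewrite in_itv/= => /andP[ax xb]; apply: dF; rewrite !ltW.
- apply: derivable_within_continuous => x; rewrite in_itv/= => xab.
  by have [] := dF x xab.
- by exists x.
Qed.

(** The common point is the supremum of the left ends, since every right end bounds all left ends
    from above. *)
Lemma nested_segments (u : nat -> R) (L : R) : 0 <= L ->
  (forall k, u k <= u k.+1 /\ u k.+1 + L / 2 ^+ k.+1 <= u k + L / 2 ^+ k) ->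
  exists x, forall k, u k <= x <= u k + L / 2 ^+ k.
Proof.
move=> L0 hu.
have ge0 k : 0 <= L / 2 ^+ k by rewrite divr_ge0// exprn_ge0.
have lo i j : u i <= u (i + j)%N.
  by elim: j => [|j IH]; rewrite ?addn0// addnS; apply: le_trans IH (hu _).1.
have hi i j : u (i + j)%N + L / 2 ^+ (i + j) <= u i + L / 2 ^+ i.
  by elim: j => [|j IH]; rewrite ?addn0// addnS; apply: le_trans (hu _).2 IH.
have cross i j : u i <= u j + L / 2 ^+ j.
  case: (leqP i j) => [ij|/ltnW ij].
    by rewrite -(subnKC ij); apply: le_trans (lo i (j - i)%N) _; rewrite lerDl.
  rewrite -(subnKC ij); apply: le_trans (hi j (i - j)%N).
  by rewrite lerDl.
have ub j : ubound (range u) (u j + L / 2 ^+ j) by move=> _ [i _ <-].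
have sr : has_sup (range u) by split; [exists (u 0%N), 0%N|exists (u 0%N + L / 2 ^+ 0)].
exists (sup (range u)) => k; apply/andP; split.
  by apply: ub_le_sup; [exact: sr.2|exists k].
by apply: ge_sup; [exact: sr.1|exact: ub].
Qed.

(** Here [T x y k] stands for a bad rectangle with lower corner [(x, y)] and sides [L / 2 ^+ k] and
    [M / 2 ^+ k]. If every bad rectangle has a bad quarter, then nested bad quarters shrink to one
    point. *)
Lemma bisection (T : R -> R -> nat -> Prop) (L M x0 y0 : R) : 0 <= L -> 0 <= M ->
  (forall x y k, T x y k -> exists x' y', [/\ T x' y' k.+1,
     x' = x \/ x' = x + L / 2 ^+ k.+1 & y' = y \/ y' = y + M / 2 ^+ k.+1]) ->
  T x0 y0 0%N ->
  exists s t, [/\ x0 <= s <= x0 + L, y0 <= t <= y0 + M & forall k, exists x y,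
    [/\ T x y k, x <= s <= x + L / 2 ^+ k & y <= t <= y + M / 2 ^+ k]].
Proof.
move=> L0 M0 step T0.
(* The choice of a quarter is made a total function; where [T] fails it returns the old corner, a
   default that is never reached from [(x0, y0)]. *)
have /choice[nx hnx] : forall w : R * R * nat, exists w' : R * R,
    T w.1.1 w.1.2 w.2 -> [/\ T w'.1 w'.2 w.2.+1,
     w'.1 = w.1.1 \/ w'.1 = w.1.1 + L / 2 ^+ w.2.+1 &
     w'.2 = w.1.2 \/ w'.2 = w.1.2 + M / 2 ^+ w.2.+1].
  move=> [[x y] k] /=; have [/step[x' [y' H]]|nT] := pselect (T x y k).
    by exists (x', y').
  by exists (x, y).
pose w := fix w k := if k is k'.+1 then nx (w k', k') else (x0, y0).
have hw k : T (w k).1 (w k).2 k.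
  by elim: k => //= k IH; have [] := hnx (w k, k) IH.
have half (K z z' : R) k : 0 <= K -> z' = z \/ z' = z + K / 2 ^+ k.+1 ->
    z <= z' /\ z' + K / 2 ^+ k.+1 <= z + K / 2 ^+ k.
  move=> K0; have := divr_ge0 K0 (exprn_ge0 k.+1 (ler0n R 2)).
  have -> : K / 2 ^+ k = K / 2 ^+ k.+1 + K / 2 ^+ k.+1.
    by rewrite -[in LHS](mulr1 K) exprS invfM; field; rewrite expf_neq0.
  by move=> ge0 [->|->]; split; lra.
have [s hs] : exists s, forall k, (w k).1 <= s <= (w k).1 + L / 2 ^+ k.
  apply: nested_segments => // k; apply: half => //.
  by have [] := hnx (w k, k) (hw k).
have [t ht] : exists t, forall k, (w k).2 <= t <= (w k).2 + M / 2 ^+ k.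
  apply: nested_segments => // k; apply: half => //.
  by have [] := hnx (w k, k) (hw k).
exists s, t; split; first by have := hs 0%N; rewrite expr0 divr1.
  by have := ht 0%N; rewrite expr0 divr1.
by move=> k; exists (w k).1, (w k).2.
Qed.

(* Only the equation [dP/ds = dQ/dt] is imposed on the partial derivatives: it
   says that the form [Q ds + P dt] is closed at [(s, t)]. *)
Definition closed_at P Q (s t : R) := exists al be ga : R,
  forall e : R, 0 < e -> exists2 d : R, 0 < d & forall s' t' : R,
    `|s' - s| < d -> `|t' - t| < d ->
    `|P s' t' - P s t - al * (s' - s) - be * (t' - t)|
       <= e * (`|s' - s| + `|t' - t|) /\
    `|Q s' t' - Q s t - ga * (s' - s) - al * (t' - t)|
       <= e * (`|s' - s| + `|t' - t|).

(** For an antiderivative [B] of [P] in the second variable this is the integral of [P] over the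
    side [s = b] minus that over [s = a]; for an antiderivative [A] of [Q] in the first variable it
    is the integral of [Q] over the side [t = d] minus that over [t = c]. The two agree exactly when
    [Q ds + P dt] has integral zero around the rectangle. *)
Definition box_diff B (a b c d : R) := B b d - B b c - (B a d - B a c).

(** The mean value theorem replaces each pair of opposite sides by one difference of values. In the
    affine approximation at [(s, t)] both pairs contribute [al (b - a) (d - c)], with the same [al],
    so only the error terms survive. *)
Lemma closed_at_box_diff P Q A B (a0 b0 c0 d0 s t : R) :
  (forall x y, a0 < x < b0 -> is_derive x 1 (A ^~ y) (Q x y)) ->
  (forall x y, a0 < x < b0 -> c0 < y < d0 -> is_derive y 1 (B x) (P x y)) ->
  closed_at P Q s t ->
  forall e : R, 0 < e -> exists2 dl : R, 0 < dl & forall a b c d,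
    a0 < a -> b < b0 -> c0 < c -> d < d0 -> a <= s <= b -> c <= t <= d ->
    (b - a) + (d - c) < dl ->
    `|box_diff B a b c d - box_diff A a b c d| <= e * ((b - a) + (d - c)) ^+ 2.
Proof.
move=> dA dB [al [be [ga H]]] e e0.
have e20 : 0 < e / 2 by rewrite divr_gt0.
have [dl dl0 {}H] := H _ e20; exists dl => // a b c d a0a bb0 c0c dd0 sab tcd bacd.
have /andP[as_ sb] := sab; have /andP[ct td] := tcd.
(* The theorem is applied to the difference of the two sides, so that both values of [P] are taken
   at the same height [y] and the [be] terms cancel. *)
have [y /andP[cy yd] EB] : exists2 y, c <= y <= d &
    (B b d - B a d) - (B b c - B a c) = (P b y - P a y) * (d - c).
  have [||y hy E] := @mean_value (fun y => B b y - B a y)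
    (fun y => P b y - P a y) c0 d0 c d c0c dd0.
  - exact: le_trans td.
  - move=> y c0y; apply: is_deriveB; apply: dB => //.
      by rewrite bb0 (lt_le_trans a0a)// (le_trans as_).
    by rewrite a0a (le_lt_trans _ bb0)// (le_trans as_).
  - by exists y.
have [x /andP[ax xb] EA] : exists2 x, a <= x <= b &
    (A b d - A b c) - (A a d - A a c) = (Q x d - Q x c) * (b - a).
  have [||x hx E] := @mean_value (fun x => A x d - A x c)
    (fun x => Q x d - Q x c) a0 b0 a b a0a bb0.
  - exact: le_trans sb.
  - by move=> x xab; apply: is_deriveB; exact: dA.
  - by exists x.
have ab0 : 0 <= b - a by clear -as_ sb; lra.
have cd0 : 0 <= d - c by clear -ct td; lra.
set K := b - a + (d - c).
have near_s z : a <= z <= b -> `|z - s| <= b - a.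
  by clear -as_ sb ct td => /andP[? ?]; rewrite ler_norml; lra.
have near_t z : c <= z <= d -> `|z - t| <= d - c.
  by clear -as_ sb ct td => /andP[? ?]; rewrite ler_norml; lra.
have HH u v : a <= u <= b -> c <= v <= d ->
    `|P u v - P s t - al * (u - s) - be * (v - t)| <= e / 2 * K /\
    `|Q u v - Q s t - ga * (u - s) - al * (v - t)| <= e / 2 * K.
  move=> hu hv; have nu := near_s _ hu; have nv := near_t _ hv.
  have nus : `|u - s| < dl by clear -nu bacd cd0; lra.
  have nvt : `|v - t| < dl by clear -nv bacd ab0; lra.
  have [h1 h2] := H u v nus nvt.
  have le : e / 2 * (`|u - s| + `|v - t|) <= e / 2 * K.
    by rewrite ler_pM2l//; apply: lerD.
  by split; [exact: le_trans h1 le|exact: le_trans h2 le].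
have [Pb _] : `|P b y - P s t - al * (b - s) - be * (y - t)| <= e / 2 * K /\
    `|Q b y - Q s t - ga * (b - s) - al * (y - t)| <= e / 2 * K.
  by apply: HH; apply/andP; split=> //; clear -as_ sb ct td; lra.
have [Pa _] : `|P a y - P s t - al * (a - s) - be * (y - t)| <= e / 2 * K /\
    `|Q a y - Q s t - ga * (a - s) - al * (y - t)| <= e / 2 * K.
  by apply: HH; apply/andP; split=> //; clear -as_ sb ct td; lra.
have [_ Qd] : `|P x d - P s t - al * (x - s) - be * (d - t)| <= e / 2 * K /\
    `|Q x d - Q s t - ga * (x - s) - al * (d - t)| <= e / 2 * K.
  by apply: HH; apply/andP; split=> //; clear -as_ sb ct td; lra.
have [_ Qc] : `|P x c - P s t - al * (x - s) - be * (c - t)| <= e / 2 * K /\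
    `|Q x c - Q s t - ga * (x - s) - al * (c - t)| <= e / 2 * K.
  by apply: HH; apply/andP; split=> //; clear -as_ sb ct td; lra.
have -> : box_diff B a b c d - box_diff A a b c d =
   ((P b y - P s t - al * (b - s) - be * (y - t))
     - (P a y - P s t - al * (a - s) - be * (y - t))) * (d - c)
   - ((Q x d - Q s t - ga * (x - s) - al * (d - t))
     - (Q x c - Q s t - ga * (x - s) - al * (c - t))) * (b - a).
  rewrite /box_diff.
  have -> : B b d - B b c - (B a d - B a c) = (P b y - P a y) * (d - c).
    by rewrite -EB; ring.
  have -> : A b d - A b c - (A a d - A a c) = (Q x d - Q x c) * (b - a).
    by rewrite -EA.
  ring.
have b1 (u v h r : R) : 0 <= h -> `|u| <= r -> `|v| <= r -> `|(u - v) * h| <= 2 * r * h.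
  move=> h0 ur vr; rewrite normrM (ger0_norm h0) ler_wpM2r//.
  by apply: le_trans (ler_normB _ _) _; rewrite mulr2n mulrDl mul1r lerD.
apply: le_trans (ler_normB _ _) _.
have -> : e * K ^+ 2 = 2 * (e / 2 * K) * (d - c) + 2 * (e / 2 * K) * (b - a).
  by rewrite /K; field.
exact: lerD (b1 _ _ _ _ cd0 Pb Pa) (b1 _ _ _ _ ab0 Qd Qc).
Qed.

(** A nonzero defect [D] keeps at least a quarter of its size on some quarter rectangle, hence at
    least [4 ^- k] of it after [k] bisections. Closedness at the limit point makes it small compared
    with the squared size of the rectangle, which is also of order [4 ^- k]. *)
Lemma goursat P Q A B (a0 b0 c0 d0 a b c d : R) :
  (forall x y, a0 < x < b0 -> is_derive x 1 (A ^~ y) (Q x y)) ->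
  (forall x y, a0 < x < b0 -> c0 < y < d0 -> is_derive y 1 (B x) (P x y)) ->
  a0 < a -> b < b0 -> c0 < c -> d < d0 -> a <= b -> c <= d ->
  (forall s t, a <= s <= b -> c <= t <= d -> closed_at P Q s t) ->
  box_diff B a b c d = box_diff A a b c d.
Proof.
move=> dA dB a0a bb0 c0c dd0 ab cd cl; apply/eqP; rewrite -subr_eq0; apply/negPn/negP => nz.
pose L := b - a; pose M := d - c; pose K := L + M.
have L0 : 0 <= L by rewrite subr_ge0.
have M0 : 0 <= M by rewrite subr_ge0.
pose D x y k := box_diff B x (x + L / 2 ^+ k) y (y + M / 2 ^+ k)
  - box_diff A x (x + L / 2 ^+ k) y (y + M / 2 ^+ k).
have D0 : 0 < `|D a c 0%N|.
  by rewrite normr_gt0 /D !expr0 !divr1 /L /M !(addrC _ (_ - _)) !subrK.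
pose T x y k := [/\ a <= x, c <= y, x + L / 2 ^+ k <= b, y + M / 2 ^+ k <= d &
  `|D a c 0%N| <= 4 ^+ k * `|D x y k|].
have step x y k : T x y k -> exists x' y', [/\ T x' y' k.+1,
     x' = x \/ x' = x + L / 2 ^+ k.+1 & y' = y \/ y' = y + M / 2 ^+ k.+1].
  rewrite /T => -[ax cy xb yd Txy]; set h := L / 2 ^+ k.+1; set m := M / 2 ^+ k.+1.
  have hh : L / 2 ^+ k = h + h.
    by rewrite /h exprS invfM; field; rewrite expf_neq0.
  have mm : M / 2 ^+ k = m + m.
    by rewrite /m exprS invfM; field; rewrite expf_neq0.
  have h0 : 0 <= h by rewrite divr_ge0// exprn_ge0.
  have m0 : 0 <= m by rewrite divr_ge0// exprn_ge0.
  apply: contrapT => no.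
  have lt x' y' : x' = x \/ x' = x + h -> y' = y \/ y' = y + m ->
      4 ^+ k.+1 * `|D x' y' k.+1| < `|D a c 0%N|.
    move=> hx' hy'; rewrite ltNge; apply/negP => le; apply: no; exists x', y'.
    split=> //; split=> //.
    - by case: hx' => -> //; rewrite (le_trans ax)// lerDl.
    - by case: hy' => -> //; rewrite (le_trans cy)// lerDl.
    - by apply: le_trans xb; rewrite hh; case: hx' => ->; rewrite ?addrA// lerD2r lerDl.
    - by apply: le_trans yd; rewrite mm; case: hy' => ->; rewrite ?addrA// lerD2r lerDl.
  have E : D x y k = D x y k.+1 + D (x + h) y k.+1 + D x (y + m) k.+1
     + D (x + h) (y + m) k.+1.
    by rewrite /D hh mm -/h -/m /box_diff !addrA; ring.
  have := lt x y (or_introl erefl) (or_introl erefl).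
  have := lt (x + h) y (or_intror erefl) (or_introl erefl).
  have := lt x (y + m) (or_introl erefl) (or_intror erefl).
  have := lt (x + h) (y + m) (or_intror erefl) (or_intror erefl).
  have : `|D x y k| <= `|D x y k.+1| + `|D (x + h) y k.+1| + `|D x (y + m) k.+1|
     + `|D (x + h) (y + m) k.+1|.
    rewrite E; apply: le_trans (ler_normD _ _) _; rewrite lerD2r.
    apply: le_trans (ler_normD _ _) _; rewrite lerD2r.
    exact: ler_normD.
  rewrite -(@ler_pM2l _ (4 ^+ k)) ?exprn_gt0// exprS.
  by clear -Txy => *; lra.
have T0 : T a c 0%N by rewrite /T expr0 mul1r !divr1 /L /M !subrKC.
have [s [t [hs ht H]]] := bisection L0 M0 step T0.
have {}cl : closed_at P Q s t.
  by apply: cl; [move: hs|move: ht]; rewrite /L /M subrKC.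
have K10 : 0 < K + 1 by rewrite ltr_wpDl// addr_ge0.
(* This constant makes the final factor [K ^ 2 / (2 (K + 1) ^ 2)] less than 1, also for a degenerate
   rectangle with [K = 0]. *)
have e0 : 0 < `|D a c 0%N| / (2 * (K + 1) ^+ 2).
  by rewrite divr_gt0// mulr_gt0// exprn_gt0.
have [dl dl0 E] := closed_at_box_diff dA dB cl e0.
have [k hk] : exists k, K / 2 ^+ k < dl.
  have : (fun k => K / 2 ^+ k) @ \oo --> (0 : R).
    rewrite -(mulr0 K); apply: cvgMr.
    under eq_fun do rewrite -exprVn.
    by apply: cvg_expr; rewrite ger0_norm// invf_lt1// ltr1n.
  move/cvgrPdist_lt => /(_ _ dl0)[k _ /(_ k (leqnn k))] /=.
  rewrite sub0r normrN => hk; exists k.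
  exact: le_lt_trans (ler_norm _) hk.
have [x [y [[ax cy xb yd Txy] xs yt]]] := H k.
have KE : L / 2 ^+ k + M / 2 ^+ k = K / 2 ^+ k by exact/esym/mulrDl.
have := E x (x + L / 2 ^+ k) y (y + M / 2 ^+ k) (lt_le_trans a0a ax)
  (le_lt_trans xb bb0) (lt_le_trans c0c cy) (le_lt_trans yd dd0) xs yt.
have addB u v : u + v - u = v :> R by ring.
rewrite !addB KE => /(_ hk).
rewrite -/(D x y k) => Dxy.
have := le_trans Txy (ler_wpM2l (exprn_ge0 k (ler0n R 4)) Dxy).
have -> : 4 ^+ k * (`|D a c 0%N| / (2 * (K + 1) ^+ 2) * (K / 2 ^+ k) ^+ 2)
    = `|D a c 0%N| * (K ^+ 2 / (2 * (K + 1) ^+ 2)).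
  have -> : (4 : R) = 2 ^+ 2 by rewrite expr2 -natrM.
  by rewrite -exprM mulnC exprM; field; rewrite expf_neq0// gt_eqF.
apply/negP; rewrite -ltNge gtr_pMr// ltr_pdivrMr ?mul1r; last first.
  by rewrite mulr_gt0// exprn_gt0.
have K0 : 0 <= K by rewrite addr_ge0.
by clear -K0; nra.
Qed.

End RealGoursat.

(** * Complex modulus and complex differentiability *)

Section Modulus.
Variable R : realType.
Implicit Types (z w : R[i]).

Lemma modulusE z : modulus z = Num.sqrt (Re z ^+ 2 + Im z ^+ 2).
Proof. by case: z. Qed.

Lemma modulus_ge0 z : 0 <= modulus z.
Proof. by rewrite modulusE sqrtr_ge0. Qed.

Lemma sqr_modulus z : modulus z ^+ 2 = Re z ^+ 2 + Im z ^+ 2.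
Proof. by rewrite modulusE sqr_sqrtr// addr_ge0// sqr_ge0. Qed.

Lemma modulusM z w : modulus (z * w) = modulus z * modulus w.
Proof. exact: ComplexField.Normc.normcM. Qed.

Lemma modulusV z : modulus z^-1 = (modulus z)^-1.
Proof. exact: ComplexField.Normc.normcV. Qed.

Lemma modulusD z w : modulus (z + w) <= modulus z + modulus w.
Proof. exact: le_normcD. Qed.

Lemma modulusN z : modulus (- z) = modulus z.
Proof. by case: z => a b /=; rewrite !sqrrN. Qed.

Lemma modulusB z w : modulus (z - w) <= modulus z + modulus w.
Proof. by rewrite -(modulusN w); exact: modulusD. Qed.

Lemma modulusC z w : modulus (z - w) = modulus (w - z).
Proof. by rewrite -modulusN opprB. Qed.

Lemma modulusJ z : modulus (conjc z) = modulus z.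
Proof. by case: z => a b /=; rewrite sqrrN. Qed.

Lemma modulus0 : modulus (0 : R[i]) = 0.
Proof. exact: ComplexField.Normc.normc0. Qed.

Lemma modulus1 : modulus (1 : R[i]) = 1.
Proof. exact: ComplexField.Normc.normc1. Qed.

Lemma modulus_real (x : R) : modulus x%:C = `|x|.
Proof. by rewrite modulusE /= expr0n addr0 sqrtr_sqr. Qed.

Lemma modulus_eq0 z : (modulus z == 0) = (z == 0).
Proof.
apply/eqP/eqP => [|->]; last exact: modulus0.
exact: ComplexField.Normc.eq0_normc.
Qed.

Lemma modulus_gt0 z : (0 < modulus z) = (z != 0).
Proof. by rewrite lt_neqAle modulus_ge0 andbT eq_sym modulus_eq0. Qed.

Lemma ler_modulusB z w : modulus z - modulus w <= modulus (z - w).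
Proof. by rewrite lerBlDr -{1}(subrK w z); exact: modulusD. Qed.

Lemma norm_Re_modulus z : `|Re z| <= modulus z.
Proof. by rewrite modulusE -sqrtr_sqr ler_wsqrtr// lerDl sqr_ge0. Qed.

Lemma norm_Im_modulus z : `|Im z| <= modulus z.
Proof. by rewrite modulusE -sqrtr_sqr ler_wsqrtr// lerDr sqr_ge0. Qed.

Lemma modulus_le_ReIm z : modulus z <= `|Re z| + `|Im z|.
Proof.
rewrite -(@ler_pXn2r _ 2)// ?nnegrE ?modulus_ge0 ?addr_ge0//.
rewrite sqr_modulus sqrrD !real_normK ?num_real// lerD2r lerDl.
by rewrite mulrn_wge0 ?mulr_ge0.
Qed.

Lemma normC_modulus z : `|z| = (modulus z)%:C.
Proof. by []. Qed.

Lemma ReD z w : Re (z + w) = Re z + Re w.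
Proof. by case: z; case: w. Qed.

Lemma ReB z w : Re (z - w) = Re z - Re w.
Proof. by case: z; case: w. Qed.

Lemma derivable_approx (K : numFieldType) (f : K -> K) (x : K) :
  derivable f x 1 -> forall e, 0 < e ->
  \forall h \near nbhs (0 : K), `|f (x + h) - f x - 'D_1 f x * h| <= e * `|h|.
Proof.
move=> /derivable_nbhsP/eqaddoP df e e0; near=> h.
have : `|((fun h : K => (f \o shift x) (h *: 1)) - (cst (f x) +
    (fun h : K => h *: 'D_1 f x))) h| <= e * `|h| by near: h; exact: df.
by rewrite /= !fctE /= /GRing.scale /= mulr1 (addrC h) opprD addrA (mulrC h).
Unshelve. all: by end_near. Qed.

Lemma real_derive_approx (f : R -> R) (x l : R) : is_derive x 1 f l ->
  forall e : R, 0 < e -> exists2 d : R, 0 < d &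
    forall h : R, `|h| < d -> `|f (x + h) - f x - l * h| <= e * `|h|.
Proof.
move=> [df <-] e e0.
have /nbhs_ballP[d /= d0 H] := derivable_approx df e0.
by exists d => // h hd; apply: H; rewrite /ball/= sub0r normrN.
Qed.

Lemma complex_derive_approx (u : R[i] -> R[i]) z : differentiable u z ->
  exists l, forall e : R, 0 < e -> exists2 d : R, 0 < d & forall w, modulus (w - z) < d ->
    modulus (u w - u z - l * (w - z)) <= e * modulus (w - z).
Proof.
move=> /derivable1_diffP du; exists ('D_1 u z) => e e0.
have e0' : 0 < e%:C :> R[i] by rewrite ltcR.
have /nbhs_ballP[d /= d0 H] := derivable_approx du e0'.
(* A positive element of [R[i]] has imaginary part zero, so the radius of a ball is a real
   number. *)
have [r Er] : exists r, d = r%:C.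
  by case: d d0 {H} => a b; rewrite ltcE /= => /andP[/eqP -> _]; exists a.
rewrite {d}Er ltcR in d0 H; exists r => // w wz.
have := H (w - z); rewrite /ball/= sub0r normrN normC_modulus ltcR => /(_ wz).
by rewrite subrKC !normC_modulus -(rmorphM (real_complex R)) lecR.
Qed.

Lemma complex_continuousP (u : R[i] -> R[i]) z : {for z, continuous u} <->
  forall e : R, 0 < e -> exists2 d : R, 0 < d &
    forall w, modulus (w - z) < d -> modulus (u w - u z) < e.
Proof.
split=> [/cvgrPdist_lt cu e e0|H].
  have e0' : 0 < e%:C :> R[i] by rewrite ltcR.
  have /nbhs_ballP[d /= d0 H] := cu _ e0'.
  have [r Er] : exists r, d = r%:C.
    by case: d d0 {H} => a b; rewrite ltcE /= => /andP[/eqP -> _]; exists a.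
  rewrite {d}Er ltcR in d0 H; exists r => // w wz.
  have := H w; rewrite /ball/= !normC_modulus !ltcR (modulusC z w) => /(_ wz).
  by rewrite modulusC.
move=> A /nbhs_ballP[e /= e0 sA].
have [r Er] : exists r, e = r%:C.
  by case: e e0 {sA} => a b; rewrite ltcE /= => /andP[/eqP -> _]; exists a.
rewrite {e}Er ltcR in e0 sA; have [d d0 {}H] := H _ e0.
apply/nbhs_ballP; exists d%:C => /=; first by rewrite ltcR.
move=> w; rewrite /ball/= !normC_modulus !ltcR modulusC => /H uw.
by apply: sA; rewrite /ball/= normC_modulus ltcR modulusC.
Qed.

End Modulus.

(** * The mean value property on circles *)

Section CircleMean.
Variable R : realType.
Implicit Types (z w : R[i]) (s t : R).

Definition expc s t : R[i] := (expR s * cos t) +i* (expR s * sin t).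

Lemma expcD s t h k : expc (s + h) (t + k) = expc s t * expc h k.
Proof.
rewrite /expc expRD cosD sinD; apply/eqP; rewrite eq_complex /=.
by apply/andP; split; apply/eqP; ring.
Qed.

Lemma modulus_expc s t : modulus (expc s t) = expR s.
Proof.
rewrite modulusE /= !exprMn -mulrDr cos2Dsin2 mulr1 sqrtr_sqr ger0_norm//.
Qed.

Lemma expc_approx (e : R) : 0 < e -> exists2 d : R, 0 < d &
  forall h k : R, `|h| < d -> `|k| < d ->
  modulus (expc h k - 1 - h +i* k) <= e * (`|h| + `|k|).
Proof.
move=> e0; have e40 : 0 < e / 8 by rewrite divr_gt0.
have [d1 d10 H1] := real_derive_approx (is_derive_expR (0 : R)) e40.
have [d2 d20 H2] := real_derive_approx (is_derive_cos (0 : R)) e40.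
have [d3 d30 H3] := real_derive_approx (is_derive_sin (0 : R)) e40.
have [d4 d40 H4] := real_derive_approx (is_derive_expR (0 : R)) ltr01.
(* The bounds [d4] and [1/2] on [h] give [|expR h| <= 2], and [e / 8] then gives
   [|expR h - 1| <= e / 4]. *)
exists (Num.min (Num.min (Num.min d1 d2) (Num.min d3 d4)) (Num.min (1/2) (e / 8))).
  by rewrite !lt_min d10 d20 d30 d40 /= !divr_gt0.
move=> h k; rewrite !lt_min => /andP[/andP[/andP[h1 _] /andP[_ h4]] /andP[h12 he8]].
move=> /andP[/andP[/andP[_ k2] /andP[k3 _]] _].
have {H1 h1} := H1 h h1; have {H4 h4} := H4 h h4.
have {H2 k2} := H2 k k2; have {H3 k3} := H3 k k3.
rewrite !add0r expR0 cos0 sin0 oppr0 !mul1r mul0r !subr0 addr0.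
set E := expR h; set C := cos k; set S := sin k => hS hC hE4 hE.
have E2 : `|E| <= 2.
  have -> : E = (E - 1 - h) + h + 1 by ring.
  apply: le_trans (ler_normD _ _) _; rewrite normr1.
  have := ler_normD (E - 1 - h) h; lra.
have E1 : `|E - 1| <= e / 4.
  have -> : E - 1 = (E - 1 - h) + h by ring.
  apply: le_trans (ler_normD _ _) _; lra.
apply: le_trans (modulus_le_ReIm _) _; rewrite /= subr0.
have -> : E * C - 1 - h = (E - 1 - h) + E * (C - 1) by ring.
have -> : E * S - k = (E - 1) * k + E * (S - k) by ring.
have b1 : `|E * (C - 1)| <= 2 * (e / 8 * `|k|) by rewrite normrM ler_pM.
have b2 : `|E * (S - k)| <= 2 * (e / 8 * `|k|) by rewrite normrM ler_pM.
have b3 : `|(E - 1) * k| <= e / 4 * `|k| by rewrite normrM; apply: ler_wpM2r.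
have := ler_normD (E - 1 - h) (E * (C - 1)).
have := ler_normD ((E - 1) * k) (E * (S - k)).
have : 0 <= e * `|h| by rewrite mulr_ge0// ltW.
have : 0 <= e * `|k| by rewrite mulr_ge0// ltW.
by clear -hE b1 b2 b3 => *; lra.
Qed.

(** By the chain rule the derivative in [s] is some [c] and the one in [t] is [i c]. Taking real and
    imaginary parts, the [s]-derivative of [Re W] and the [t]-derivative of [Im W] are both
    [Re c]. *)
Lemma closed_at_polar (W : R[i] -> R[i]) (a : R[i]) (rho s t : R) :
  differentiable W (a + rho%:C * expc s t) ->
  closed_at (fun s t => Re (W (a + rho%:C * expc s t)))
            (fun s t => Im (W (a + rho%:C * expc s t))) s t.
Proof.
set z := a + _ => dW; have [l Hl] := complex_derive_approx dW.
pose m := rho%:C * expc s t; pose c := l * m.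
exists (Re c), (- Im c), (Im c) => e e0.
pose N := modulus m + 1; pose L := modulus l + 1.
have N0 : 0 < N by rewrite ltr_wpDl// modulus_ge0.
have L0 : 0 < L by rewrite ltr_wpDl// modulus_ge0.
have e1 : 0 < e / (2 * L * N) by rewrite divr_gt0// !mulr_gt0.
have e2 : 0 < e / (6 * N) by rewrite divr_gt0// mulr_gt0.
have [d1 d10 H1] := expc_approx e1; have [d2 d20 H2] := expc_approx (ltr01 : (0 : R) < 1).
have [d3 d30 H3] := Hl _ e2.
(* [d1] controls the error in the expansion of [expc], [d2] gives the crude bound
   [|z' - z| <= 2 N D], and [d3 / (6 N)] then places [z'] within [d3] of [z]. *)
exists (Num.min (Num.min d1 d2) (d3 / (6 * N))).
  by rewrite !lt_min d10 d20 divr_gt0// mulr_gt0.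
move=> s' t'; rewrite !lt_min => /andP[/andP[s1 s2] s3] /andP[/andP[t1 t2] t3].
set h := s' - s; set k := t' - t; pose q := h +i* k.
set D := `|h| + `|k|.
have D0 : 0 <= D by rewrite addr_ge0.
set z' := a + rho%:C * expc s' t'.
have zE : z' - z = m * (expc h k - 1).
  rewrite /z' -(subrKC s s') -(subrKC t t') expcD -/h -/k /z /m; ring.
have {H1} : modulus (expc h k - 1 - q) <= e / (2 * L * N) * D by exact: H1.
have {H2} : modulus (expc h k - 1 - q) <= D by rewrite -[leRHS]mul1r; exact: H2.
move=> H2 H1.
have qD : modulus q <= D by exact: modulus_le_ReIm.
have zD : modulus (z' - z) <= 2 * N * D.
  rewrite zE modulusM.
  have -> : expc h k - 1 = (expc h k - 1 - q) + q by rewrite subrK.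
  have le2 : modulus (expc h k - 1 - q + q) <= 2 * D.
    by apply: le_trans (modulusD _ _) _; rewrite mulr2n mulrDl mul1r lerD.
  rewrite (mulrC 2) -mulrA ler_pM ?modulus_ge0//.
  by rewrite /N lerDl.
have zd3 : modulus (z' - z) < d3.
  apply: le_lt_trans zD _.
  have : D < d3 / (6 * N) + d3 / (6 * N) by rewrite ltrD.
  have -> : d3 / (6 * N) + d3 / (6 * N) = d3 / (3 * N) by field; rewrite gt_eqF.
  rewrite ltr_pdivlMr ?mulr_gt0// => lt.
  have := mulr_ge0 D0 (ltW N0); by clear -lt => *; lra.
have {}H3 := H3 _ zd3.
have key : modulus (W z' - W z - c * q) <= e * D.
  have -> : W z' - W z - c * q
      = (W z' - W z - l * (z' - z)) + c * (expc h k - 1 - q).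
    by rewrite zE /c; ring.
  apply: le_trans (modulusD _ _) _.
  have b1 : modulus (W z' - W z - l * (z' - z)) <= e / 2 * D.
    apply: le_trans H3 _.
    apply: le_trans (ler_wpM2l (ltW e2) zD) _.
    have -> : e / (6 * N) * (2 * N * D) = e / 3 * D by field; rewrite gt_eqF.
    by apply: ler_wpM2r => //; clear -e0; lra.
  have b2 : modulus (c * (expc h k - 1 - q)) <= e / 2 * D.
    rewrite modulusM; apply: le_trans (_ : L * N * (e / (2 * L * N) * D) <= _).
      apply: ler_pM; rewrite ?modulus_ge0// /c modulusM.
      by apply: ler_pM; rewrite ?modulus_ge0// lerDl.
    by rewrite le_eqVlt; apply/orP; left; apply/eqP; field; rewrite !gt_eqF.
  by clear -b1 b2; lra.
have EP : Re (W z') - Re (W z) - Re c * h - - Im c * k = Re (W z' - W z - c * q).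
  by rewrite /q; case: (W z') => ? ?; case: (W z) => ? ?; case: (c) => ? ? /=; ring.
have EQ : Im (W z') - Im (W z) - Im c * h - Re c * k = Im (W z' - W z - c * q).
  by rewrite /q; case: (W z') => ? ?; case: (W z) => ? ?; case: (c) => ? ? /=; ring.
rewrite EP EQ; split; apply: le_trans key.
  exact: norm_Re_modulus.
exact: norm_Im_modulus.
Qed.

(** Provides continuity along the sides of rectangles, the condition under which [antiderivative]
    applies. *)
Lemma closed_at_continuous (P Q : R -> R -> R) s t : closed_at P Q s t ->
  {for s, continuous (Q ^~ t)} /\ {for t, continuous (P s)}.
Proof.
move=> [al [be [ga /(_ _ ltr01)[d d0 H]]]]; split.
  apply/cvgrPdist_lt => e e0; near=> s'.
  have ss : `|s' - s| < d by rewrite distrC; near: s'; exact: cvgr_dist_lt.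
  have se : `|s' - s| * (1 + `|ga|) < e.
    rewrite -ltr_pdivlMr ?ltr_wpDr// distrC; near: s'.
    apply: cvgr_dist_lt => //; rewrite divr_gt0// ltr_wpDr.
  have [_] := H s' t ss (ltac:(by rewrite subrr normr0)).
  rewrite subrr normr0 mulr0 subr0 addr0 mul1r => le; rewrite distrC.
  have -> : Q s' t - Q s t = (Q s' t - Q s t - ga * (s' - s)) + ga * (s' - s) by ring.
  apply: le_lt_trans (ler_normD _ _) _; rewrite normrM.
  by clear -le se; lra.
apply/cvgrPdist_lt => e e0; near=> t'.
have tt : `|t' - t| < d by rewrite distrC; near: t'; exact: cvgr_dist_lt.
have te : `|t' - t| * (1 + `|be|) < e.
  rewrite -ltr_pdivlMr ?ltr_wpDr// distrC; near: t'.
  apply: cvgr_dist_lt => //; rewrite divr_gt0// ltr_wpDr.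
have [+ _] := H s t' (ltac:(by rewrite subrr normr0)) tt.
rewrite subrr normr0 mulr0 subr0 add0r mul1r => le; rewrite distrC.
have -> : P s t' - P s t = (P s t' - P s t - be * (t' - t)) + be * (t' - t) by ring.
apply: le_lt_trans (ler_normD _ _) _; rewrite normrM.
by clear -le te; lra.
Unshelve. all: by end_near. Qed.

(* In logarithmic polar coordinates [z = a + rho * exp (s + i t)] the two
   horizontal sides of the rectangle [s0 <= s <= 0], [0 <= t <= 2 pi] cancel by
   periodicity, so Goursat's lemma says that the mean of [Re W] over circles
   does not depend on the radius; it tends to [Re (W a)] as [s0] tends to -oo. *)
Lemma no_strict_circle_max (W : R[i] -> R[i]) (a : R[i]) (rho r eta : R) :
  0 < rho < r -> 0 < eta ->
  (forall z, 0 < modulus (z - a) < r -> differentiable W z) ->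
  {for a, continuous W} ->
  ~ (forall z, modulus (z - a) = rho -> Re (W z) <= Re (W a) - eta).
Proof.
move=> /andP[rho0 rhor] eta0 dW /complex_continuousP cW hW.
pose P s t := Re (W (a + rho%:C * expc s t)).
pose Q s t := Im (W (a + rho%:C * expc s t)).
have mE s t : modulus (a + rho%:C * expc s t - a) = rho * expR s.
  by rewrite addrAC subrr add0r modulusM modulus_expc modulus_real gtr0_norm.
(* The margin beyond [s = 0] that Goursat's theorem requires, still inside the disc of radius
   [r]. *)
have [b0 b00 hb] : exists2 b0 : R, 0 < b0 & rho * expR b0 < r.
  exists (ln (r / rho) / 2).
    by rewrite divr_gt0// ln_gt0// ltr_pdivlMr// mul1r.
  rewrite mulrC -ltr_pdivlMr//.
  have rr : 1 < r / rho by rewrite ltr_pdivlMr// mul1r.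
  rewrite -[ltRHS]lnK ?posrE ?(lt_trans ltr01)// ltr_expR.
  by rewrite ltr_pdivrMr// mulr_natr mulr2n ltrDl ln_gt0.
have cl s t : s <= b0 -> closed_at P Q s t.
  move=> sb; apply: closed_at_polar; apply: dW; rewrite mE.
  rewrite mulr_gt0 ?expR_gt0//= (le_lt_trans _ hb)// ler_wpM2l ?(ltW rho0)//.
  by rewrite ler_expR.
have [d d0 {}cW] := cW eta eta0.
have [s0 s00 hs0] : exists2 s0 : R, s0 <= 0 & rho * expR s0 < d.
  have dr : 0 < d / (2 * rho) by rewrite divr_gt0// mulr_gt0.
  exists (Num.min 0 (ln (d / (2 * rho)))); first by rewrite ge_min lexx.
  apply: le_lt_trans (_ : rho * (d / (2 * rho)) < _).
    rewrite ler_wpM2l ?(ltW rho0)// -[leRHS]lnK ?posrE// ler_expR.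
    by rewrite ge_min lexx orbT.
  have -> : rho * (d / (2 * rho)) = d / 2 by field; rewrite gt_eqF.
  by rewrite ltr_pdivrMr// ltr_pMr// ltr1n.
pose p2 : R := pi *+ 2.
have p20 : 0 < p2 by rewrite pmulrn_lgt0// pi_gt0.
(* [G] assigns an antiderivative to the function itself and not to the height [t]. As [Q] has period
   [2 pi] in [t], the heights [0] and [2 pi] receive the same antiderivative, and the two horizontal
   sides cancel without any constant of integration. *)
have /choice[G hG] : forall f : R -> R, exists F : R -> R,
    (forall x, s0 - 1 <= x <= b0 -> {for x, continuous f}) ->
    forall x, s0 - 1 < x < b0 -> is_derive x 1 F (f x).
  move=> f; have [/antiderivative[F hF]|nc] :=
      pselect (forall x, s0 - 1 <= x <= b0 -> {for x, continuous f}).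
    by exists F.
  by exists f.
pose A s t := G (Q ^~ t) s.
have dA s t : s0 - 1 < s < b0 -> is_derive s 1 (A ^~ t) (Q s t).
  apply: hG => x /andP[_ xb].
  exact: (closed_at_continuous (cl x t xb)).1.
have /choice[B hB] : forall s, exists F : R -> R, s <= b0 ->
    forall x, - 1 < x < p2 + 1 -> is_derive x 1 F (P s x).
  move=> s; have [sb|bs] := leP s b0; last by exists (P s).
  have [x _|F hF] := @antiderivative R (P s) (- 1) (p2 + 1).
    exact: (closed_at_continuous (cl s x sb)).2.
  by exists F.
have dB s t : s0 - 1 < s < b0 -> - 1 < t < p2 + 1 -> is_derive t 1 (B s) (P s t).
  by move=> /andP[_ sb]; apply: hB; exact: ltW.
have s0s0 : s0 - 1 < s0 by rewrite ltrBlDr ltrDl.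
have N10 : - 1 < 0 :> R by rewrite oppr_lt0.
have pp1 : p2 < p2 + 1 by rewrite ltrDl.
have := goursat dA dB s0s0 b00 N10 pp1 s00 (ltW p20)
  (fun s t hs _ => cl s t (le_trans (andP hs).2 (ltW b00))).
have per : A ^~ p2 = A ^~ 0.
  apply/funext => s; rewrite /A; congr (G _ s); apply/funext => x.
  by rewrite /Q /expc /p2 cos2pi sin2pi cos0 sin0.
rewrite /box_diff -![A _ p2]/((A ^~ p2) _) per !subrr.
(* The integral of [Re W] over a circle is [2 pi] times one of its values there. So a value on the
   circle of radius [rho] equals a value on the small circle, which differs from [Re (W a)] by less
   than [eta]. *)
have mv s : s0 <= s <= 0 -> exists t, B s p2 - B s 0 = P s t * p2.
  move=> /andP[ss s0']; have [|t _ ->] := mean_value N10 pp1 (ltW p20) (dB s ^~ _).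
    by rewrite (lt_le_trans s0s0)//= (le_lt_trans s0').
  by exists t; rewrite subr0.
have [|t1 ->] := mv 0; first by rewrite s00 lexx.
have [|t2 ->] := mv s0; first by rewrite s00 lexx.
move/eqP; rewrite subr_eq0 => /eqP/(mulIf (lt0r_neq0 p20)) E.
have h1 : P 0 t1 <= Re (W a) - eta by apply: hW; rewrite mE expR0 mulr1.
have h2 : modulus (W (a + rho%:C * expc s0 t2) - W a) < eta by apply: cW; rewrite mE.
have := le_trans (ler_norm _) (norm_Re_modulus (W a - W (a + rho%:C * expc s0 t2))).
rewrite modulusC ReB -/(P s0 t2) -E => h3.
by clear -h1 h2 h3; lra.
Qed.

End CircleMean.

(** * The Schwarz lemma *)

Section Schwarz.
Variable R : realType.
Implicit Types (z w : R[i]).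

Lemma Re_mulJ z w :
  2 * Re (conjc z * w) = modulus z ^+ 2 + modulus w ^+ 2 - modulus (w - z) ^+ 2.
Proof. by rewrite !sqr_modulus; case: z => a b; case: w => c d /=; ring. Qed.

Lemma Re_real_mul (x : R) z : Re (x%:C * z) = x * Re z.
Proof. by case: z => a b /=; rewrite mul0r subr0. Qed.

(* The perturbation [eps * |z|^2] is strictly subharmonic, which turns the
   mean value inequality into a quantitative one. *)
Lemma no_circle_max (u : R[i] -> R[i]) (a : R[i]) (rho r eps : R) :
  0 < rho < r -> 0 < eps ->
  (forall z, 0 < modulus (z - a) < r -> differentiable u z) ->
  {for a, continuous u} ->
  ~ (forall z, modulus (z - a) = rho ->
      modulus (u z) ^+ 2 + eps * modulus z ^+ 2 <=
      modulus (u a) ^+ 2 + eps * modulus a ^+ 2 + eps * rho ^+ 2 / 2).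
Proof.
move=> rr eps0 du cu hu; have /andP[rho0 _] := rr.
(* Write [Phi] for [|u|^2 + eps |z|^2]. Polarization gives [2 Re (W z) = Phi z + Phi a - |u z - u
   a|^2 - eps |z - a|^2]. An excess of [Phi z] over [Phi a] of at most [eps rho^2 / 2] thus leaves
   [Re W] at least [eps rho^2 / 4] below its value at [a]. *)
pose W z := conjc (u a) * u z + (eps%:C * conjc a) * z.
have eta0 : 0 < eps * rho ^+ 2 / 4 by rewrite divr_gt0// mulr_gt0// exprn_gt0.
have dW z : 0 < modulus (z - a) < r -> differentiable W z.
  move=> /du duz; apply: differentiableD; apply: differentiableM => //.
have cW : {for a, continuous W}.
  apply/complex_continuousP => e e0.
  pose A := modulus (u a) + 1; pose B := eps * modulus a + 1.
  have A0 : 0 < A by rewrite ltr_wpDl// modulus_ge0.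
  have B0 : 0 < B by rewrite ltr_wpDl// mulr_ge0 ?modulus_ge0// ltW.
  have eA : 0 < e / (2 * A) by rewrite divr_gt0// mulr_gt0.
  have eB : 0 < e / (2 * B) by rewrite divr_gt0// mulr_gt0.
  have [d d0 hd] := (complex_continuousP u a).1 cu _ eA.
  exists (Num.min d (e / (2 * B))); first by rewrite lt_min d0.
  move=> w; rewrite lt_min => /andP[/hd wd weB].
  have -> : W w - W a = conjc (u a) * (u w - u a) + (eps%:C * conjc a) * (w - a).
    by rewrite /W; ring.
  apply: le_lt_trans (modulusD _ _) _; rewrite !modulusM !modulusJ modulus_real gtr0_norm//.
  have le1 : modulus (u a) * modulus (u w - u a) <= A * modulus (u w - u a).
    by rewrite ler_wpM2r ?modulus_ge0// lerDl.
  have le2 : eps * modulus a * modulus (w - a) <= B * modulus (w - a).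
    by rewrite ler_wpM2r ?modulus_ge0// lerDl.
  have lt1 : A * modulus (u w - u a) < e / 2.
    by rewrite mulrC -ltr_pdivlMr//; apply: lt_le_trans wd _; rewrite invfM mulrA.
  have lt2 : B * modulus (w - a) < e / 2.
    by rewrite mulrC -ltr_pdivlMr//; apply: lt_le_trans weB _; rewrite invfM mulrA.
  by clear -le1 le2 lt1 lt2; lra.
apply: (no_strict_circle_max rr eta0 dW cW) => z zrho.
have Re2 w : 2 * Re (W w) = modulus (u a) ^+ 2 + modulus (u w) ^+ 2
    - modulus (u w - u a) ^+ 2
    + eps * (modulus a ^+ 2 + modulus w ^+ 2 - modulus (w - a) ^+ 2).
  by rewrite ReD mulrDr Re_mulJ -mulrA Re_real_mul mulrCA Re_mulJ.
have := Re2 z; have := Re2 a; rewrite !subrr modulus0 zrho.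
have := hu z zrho; have := sqr_ge0 (modulus (u z - u a)).
by clear => *; nra.
Qed.

(** A maximum principle for [u = g z / z], where [|u| <= 1 / |z|]. If [|u|] exceeded 1 somewhere,
    points where [Phi] nearly reaches its supremum would stay away from the unit circle, and a small
    circle around one of them contradicts [no_circle_max]. *)
Lemma schwarz_quotient (u : R[i] -> R[i]) :
  (forall z, 0 < modulus z < 1 -> differentiable u z) ->
  {for 0, continuous u} ->
  (forall z, modulus z < 1 -> modulus (u z) * modulus z <= 1) ->
  forall z, modulus z < 1 -> modulus (u z) <= 1.
Proof.
move=> du cu hu z0 z01; rewrite leNgt; apply/negP => u1.
have /complex_continuousP cu' := cu.
(* Then [|u z0|^2 = 1 + 2 eps], so the supremum [S] of [Phi] is at least [1 + 2 eps] and [S - eps]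
   still exceeds 1. *)
pose eps := (modulus (u z0) ^+ 2 - 1) / 2.
have eps0 : 0 < eps by rewrite divr_gt0// subr_gt0 exprn_egt1.
pose Phi z := modulus (u z) ^+ 2 + eps * modulus z ^+ 2.
pose V := [set Phi z | z in [set z | modulus z < 1]].
have [K hK] : exists K, ubound V K.
  have [d0 d00 hd0] := cu' 1 ltr01.
  have i0 : 0 < d0^-1 by rewrite invr_gt0.
  exists ((modulus (u 0) + 1 + d0^-1) ^+ 2 + eps) => _ [z /= z1 <-].
  have m0 := modulus_ge0 (u 0); have mz := modulus_ge0 z.
  apply: lerD; last by rewrite ler_piMr ?(ltW eps0)// expr_le1// ltW.
  rewrite lerXn2r ?nnegrE ?modulus_ge0 ?addr_ge0 ?(ltW i0)//.
  have [zd|dz] := ltP (modulus z) d0.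
    have := hd0 z; rewrite subr0 => /(_ zd) h.
    have := ler_modulusB (u z) (u 0).
    by clear -h i0 => *; lra.
  have := hu z z1 => h.
  have : modulus (u z) <= d0^-1.
    rewrite -[d0^-1]mul1r ler_pdivlMr//.
    by apply: le_trans h; apply: ler_wpM2l; rewrite ?modulus_ge0.
  by clear -m0 => *; lra.
have Vz0 : V (Phi z0) by exists z0.
have sV : has_sup V by split; [exists (Phi z0)|exists K].
set S := sup V.
have PhiS z : modulus z < 1 -> Phi z <= S.
  by move=> z1; apply: ub_le_sup; [exact: sV.2|exists z].
pose ka := S - eps.
have ka1 : 1 < ka.
  have := PhiS z0 z01; rewrite /Phi /ka /S.
  have : 0 <= eps * modulus z0 ^+ 2 by rewrite mulr_ge0 ?sqr_ge0// ltW.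
  by move: eps0; rewrite /eps; clear; lra.
pose m := (1 + ka) / 2.
have m1 : 1 < m by rewrite /m; clear -ka1; lra.
pose r0 := Num.sqrt m^-1.
have m0 : 0 < m by exact: lt_trans m1.
have r01 : r0 < 1.
  by rewrite -sqrtr1 ltr_sqrt// invf_lt1.
have near_r0 a : modulus a < 1 -> S - (ka - 1) / 2 < Phi a -> modulus a <= r0.
  move=> a1 aS.
  have mua : m <= modulus (u a) ^+ 2.
    have : eps * modulus a ^+ 2 <= eps.
      by rewrite ler_piMr ?(ltW eps0)// expr_le1 ?modulus_ge0// ltW.
    by move: aS; rewrite /Phi /m /ka; clear; lra.
  rewrite -(@ler_pXn2r _ 2)// ?nnegrE ?modulus_ge0 ?sqrtr_ge0//.
  rewrite sqr_sqrtr ?invr_ge0 ?(ltW m0)//.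
  rewrite -[m^-1]mul1r ler_pdivlMr//.
  apply: le_trans (_ : modulus a ^+ 2 * modulus (u a) ^+ 2 <= _).
    by rewrite ler_wpM2l// sqr_ge0.
  by rewrite -exprMn expr_le1// ?mulr_ge0 ?modulus_ge0// mulrC hu.
(* The point 0 needs care, as [u] is only continuous there. If [Phi] attains [S] at 0, a circle
   about 0 gives the contradiction; otherwise continuity keeps near-maximal points away from 0. *)
have [PS|SP] := leP S (Phi 0).
  have half01 : 0 < (1 / 2 : R) < 1 by apply/andP; split; clear; lra.
  have du0 z : 0 < modulus (z - 0) < 1 -> differentiable u z.
    by rewrite subr0; exact: du.
  apply: (no_circle_max half01 eps0 du0 cu) => z; rewrite subr0 => zE.
  apply: le_trans (PhiS z _) _; first by rewrite zE; clear; lra.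
  by apply: le_trans PS _; rewrite lerDl divr_ge0// mulr_ge0 ?sqr_ge0// ltW.
pose gap := S - Phi 0.
have gap0 : 0 < gap by rewrite subr_gt0.
have [dl dl0 hdl] : exists2 dl : R, 0 < dl & forall z, modulus z < dl -> Phi z <= S - gap / 2.
  pose c := modulus (u 0).
  have c0 : 0 <= c := modulus_ge0 _.
  have cc : 0 < 4 * (2 * c + 1) by rewrite mulr_gt0// ltr_wpDl// mulr_ge0.
  pose e := Num.min 1 (gap / (4 * (2 * c + 1))).
  have e0 : 0 < e by rewrite lt_min ltr01 divr_gt0.
  have [d d0 hd] := cu' e e0.
  have e4 : 0 < 4 * eps by rewrite mulr_gt0.
  exists (Num.min d (Num.min 1 (gap / (4 * eps)))).
    by rewrite !lt_min d0 ltr01 divr_gt0.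
  move=> z; rewrite !lt_min => /andP[zd /andP[z1 zg]].
  have {hd} := hd z; rewrite subr0 => /(_ zd) h.
  have uz : modulus (u z) <= c + e.
    by have := ler_modulusB (u z) (u 0); rewrite -/c; clear -h => *; lra.
  have e1 : e <= 1 by rewrite ge_min lexx.
  have eg : e * (4 * (2 * c + 1)) <= gap.
    by rewrite -ler_pdivlMr// ge_min lexx orbT.
  have u2 : modulus (u z) ^+ 2 <= c ^+ 2 + gap / 4.
    apply: le_trans (_ : (c + e) ^+ 2 <= _).
      by rewrite lerXn2r ?nnegrE ?modulus_ge0// addr_ge0// ltW.
    by clear -e0 e1 eg c0; nra.
  have z2 : eps * modulus z ^+ 2 <= gap / 4.
    move: zg; rewrite ltr_pdivlMr// => zg.
    have mz := modulus_ge0 z.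
    apply: le_trans (_ : eps * modulus z <= _); last by clear -zg; lra.
    by rewrite ler_wpM2l ?(ltW eps0)// expr2 ler_piMl// ltW.
  move: u2 z2; rewrite /gap /Phi -/c modulus0 expr0n mulr0 addr0; clear.
  by rewrite -/c; lra.
pose r := Num.min dl (1 - r0).
have r_gt0 : 0 < r by rewrite lt_min dl0 subr_gt0.
pose rho := r / 2.
have rho0 : 0 < rho by rewrite divr_gt0.
have rhor : rho < r by rewrite /rho; clear -r_gt0; lra.
(* The supremum need not be attained, so [rho] is fixed before the near-maximal point [a]. The three
   bounds keep [a] off the unit circle, off 0, and within the slack allowed by [no_circle_max]. *)
pose tau := Num.min ((ka - 1) / 2) (Num.min (gap / 2) (eps * rho ^+ 2 / 2)).
have tau0 : 0 < tau.
  rewrite !lt_min !divr_gt0//= ?subr_gt0// mulr_gt0// exprn_gt0//.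
have [_ [a /= a1 <-] aS] := sup_adherent tau0 sV.
have [t1 t2 t3] : [/\ tau <= (ka - 1) / 2, tau <= gap / 2 & tau <= eps * rho ^+ 2 / 2].
  by split; rewrite !ge_min lexx ?orbT.
have ar0 : modulus a <= r0.
  by apply: near_r0 => //; apply: le_lt_trans aS; rewrite lerD2l lerN2.
have adl : dl <= modulus a.
  rewrite leNgt; apply/negP => /hdl; rewrite leNgt => /negP; apply.
  by apply: le_lt_trans aS; rewrite lerD2l lerN2.
have [rdl rr0] : r <= dl /\ r <= 1 - r0 by rewrite !ge_min !lexx orbT.
have disc z : modulus (z - a) < r -> 0 < modulus z < 1.
  move=> za; have := ler_modulusB z a; have := ler_modulusB a z.
  rewrite (modulusC a) => h1 h2.
  by apply/andP; split; clear -h1 h2 za ar0 adl rdl rr0; lra.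
have rr : 0 < rho < r by rewrite rho0.
have dua z : 0 < modulus (z - a) < r -> differentiable u z.
  by move=> /andP[_ /disc]; exact: du.
have cua : {for a, continuous u}.
  apply: differentiable_continuous; apply: du.
  by rewrite a1 (lt_le_trans dl0).
apply: (no_circle_max rr eps0 dua cua) => z za; apply: le_trans (PhiS z _) _.
  by have /andP[] : 0 < modulus z < 1 by apply: disc; rewrite za.
by move: aS; rewrite -/S -/(Phi a) => aS; clear -aS t3; lra.
Qed.

Lemma schwarz (g : R[i] -> R[i]) :
  (forall z, modulus z < 1 -> differentiable g z) ->
  (forall z, modulus z < 1 -> modulus (g z) <= 1) -> g 0 = 0 ->
  forall z, modulus z < 1 -> modulus (g z) <= modulus z.
Proof.
move=> dg hg g0 z z1.
have [l Hl] : exists l, forall e : R, 0 < e -> exists2 d : R, 0 < d &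
    forall w, modulus w < d -> modulus (g w - l * w) <= e * modulus w.
  have [|l Hl] := @complex_derive_approx _ g 0; first by apply: dg; rewrite modulus0.
  exists l => e e0; have [d d0 hd] := Hl e e0; exists d => // w.
  by have := hd w; rewrite !subr0 g0 subr0.
(* The value at 0 is the derivative of [g], which makes [u] continuous there; differentiability at 0
   is not asked by [schwarz_quotient], so no removable singularity theorem enters. *)
pose u w := if w == 0 then l else g w / w.
have gu w : g w = u w * w.
  by rewrite /u; case: eqP => [->|/eqP w0]; rewrite ?g0 ?mulr0// divfK.
suff u1 : modulus (u z) <= 1.
  by rewrite gu modulusM ler_piMl ?modulus_ge0.
apply: schwarz_quotient z1 => {z}.
- move=> z /andP[z0 z1]; rewrite modulus_gt0 in z0.
  have dgz : differentiable (fun w => g w / w) z.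
    apply: differentiableM; first exact: dg.
    by apply: differentiableV.
  apply/derivable1_diffP; move/derivable1_diffP : dgz; apply: near_eq_derivable.
  apply/nbhs_ballP; exists (modulus z)%:C => /=; first by rewrite ltcR modulus_gt0.
  move=> w; rewrite /ball/= normC_modulus ltcR => zw.
  by rewrite /u; case: eqP zw => // ->; rewrite subr0 ltxx.
- apply/complex_continuousP => e e0.
  have e20 : 0 < e / 2 by rewrite divr_gt0.
  have [d d0 hd] := Hl _ e20; exists d => // w; rewrite subr0 => wd.
  rewrite /u eqxx; case: eqP => [_|/eqP w0]; first by rewrite subrr modulus0.
  have -> : g w / w - l = (g w - l * w) / w by rewrite mulrBl mulfK.
  rewrite modulusM modulusV; apply: le_lt_trans (_ : e / 2 < e).
    by rewrite ler_pdivrMr ?modulus_gt0// hd.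
  by rewrite ltr_pdivrMr// ltr_pMr// ltr1n.
- by move=> z z1; rewrite -modulusM -gu hg.
Qed.

End Schwarz.

(** * Schwarz-Pick *)

Section SchwarzPick.
Variable R : realType.
Implicit Types (a b z w : R[i]).

Definition mobius a z := (z - a) / (1 - conjc a * z).

Lemma mobius_identity a z : modulus (1 - conjc a * z) ^+ 2 - modulus (z - a) ^+ 2
  = (1 - modulus a ^+ 2) * (1 - modulus z ^+ 2).
Proof. by rewrite !sqr_modulus; case: a => ? ?; case: z => ? ? /=; ring. Qed.

Lemma sqr_modulus_lt1 z : (modulus z ^+ 2 < 1) = (modulus z < 1).
Proof. by rewrite expr_lt1// modulus_ge0. Qed.

Lemma mobius_den_gt a z : modulus a < 1 -> modulus z < 1 ->
  modulus (z - a) < modulus (1 - conjc a * z).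
Proof.
move=> a1 z1; rewrite -(@ltr_pXn2r _ 2)// ?nnegrE ?modulus_ge0//.
by rewrite -subr_gt0 mobius_identity mulr_gt0// subr_gt0 sqr_modulus_lt1.
Qed.

Lemma mobius_den_neq0 a z : modulus a < 1 -> modulus z < 1 -> 1 - conjc a * z != 0.
Proof.
move=> a1 z1; rewrite -modulus_gt0.
exact: le_lt_trans (modulus_ge0 _) (mobius_den_gt a1 z1).
Qed.

Lemma mobius_lt1 a z : modulus a < 1 -> modulus z < 1 -> modulus (mobius a z) < 1.
Proof.
move=> a1 z1; rewrite /mobius modulusM modulusV.
by rewrite ltr_pdivrMr ?modulus_gt0 ?mobius_den_neq0// mul1r mobius_den_gt.
Qed.

Lemma mobiusK a z : modulus a < 1 -> modulus z < 1 -> mobius (- a) (mobius a z) = z.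
Proof.
move=> a1 z1; have Na1 : modulus (- a) < 1 by rewrite modulusN.
have d1 := mobius_den_neq0 a1 z1.
have d2 := mobius_den_neq0 Na1 (mobius_lt1 a1 z1).
have d3 := mobius_den_neq0 a1 a1.
move: d2; rewrite /mobius; have -> : conjc (- a) = - conjc a by case: (a).
set c := conjc a in d1 d3 *; rewrite opprK => d2.
have E : 1 - - c * ((z - a) / (1 - c * z)) = (1 - c * a) / (1 - c * z).
  by field.
by rewrite E; field; rewrite d1 d3.
Qed.

Lemma differentiable_mobius a z : modulus a < 1 -> modulus z < 1 ->
  differentiable (mobius a) z.
Proof.
move=> a1 z1; apply: differentiableM; first exact: differentiableB.
apply: differentiableV; last exact: mobius_den_neq0.
by apply: differentiableB => //; apply: differentiableM.
Qed.

Lemma schwarz_pick (h : R[i] -> R[i]) :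
  (forall z, modulus z < 1 -> differentiable h z) ->
  (forall z, modulus z < 1 -> modulus (h z) < 1) ->
  forall a b, modulus a < 1 -> modulus b < 1 ->
    modulus (mobius (h b) (h a)) <= modulus (mobius b a).
Proof.
move=> dh hh a b a1 b1.
have Nb1 : modulus (- b) < 1 by rewrite modulusN.
pose g z := mobius (h b) (h (mobius (- b) z)).
have m0 : mobius (- b) 0 = b by rewrite /mobius mulr0 subr0 divr1 sub0r opprK.
rewrite -{1}(mobiusK b1 a1) -/(g (mobius b a)).
apply: schwarz; last exact: mobius_lt1.
- move=> z z1; have mz := mobius_lt1 Nb1 z1.
  apply: (@differentiable_comp _ _ _ _ (fun z => h (mobius (- b) z)) (mobius (h b))).
    apply: (@differentiable_comp _ _ _ _ (mobius (- b)) h).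
      exact: differentiable_mobius.
    exact: dh.
  by apply: differentiable_mobius; apply: hh.
- by move=> z z1; apply/ltW/mobius_lt1; apply: hh => //; exact: mobius_lt1.
- by rewrite /g m0 /mobius subrr mul0r.
Qed.

Lemma sqr_mobius a z : modulus a < 1 -> modulus z < 1 ->
  modulus (mobius a z) ^+ 2
  = 1 - (1 - modulus a ^+ 2) * (1 - modulus z ^+ 2) / modulus (1 - conjc a * z) ^+ 2.
Proof.
move=> a1 z1; have d0 : modulus (1 - conjc a * z) ^+ 2 != 0.
  by rewrite expf_neq0// modulus_eq0 mobius_den_neq0.
rewrite /mobius modulusM modulusV exprMn exprVn -mobius_identity mulrBl divff//.
by rewrite subKr.
Qed.

(** Schwarz-Pick with denominators cleared, a form that survives letting [b] tend to the
    boundary. *)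
Lemma schwarz_pick_le (h : R[i] -> R[i]) :
  (forall z, modulus z < 1 -> differentiable h z) ->
  (forall z, modulus z < 1 -> modulus (h z) < 1) ->
  forall a b, modulus a < 1 -> modulus b < 1 ->
    (1 - modulus b ^+ 2) * (1 - modulus a ^+ 2) * modulus (1 - conjc (h b) * h a) ^+ 2
    <= (1 - modulus (h b) ^+ 2) * (1 - modulus (h a) ^+ 2) * modulus (1 - conjc b * a) ^+ 2.
Proof.
move=> dh hh a b a1 b1; have := schwarz_pick dh hh a1 b1.
rewrite -(@ler_pXn2r _ 2)// ?nnegrE ?modulus_ge0// !sqr_mobius ?hh//.
have pos (c d : R[i]) : modulus c < 1 -> modulus d < 1 -> 0 < modulus (1 - conjc c * d) ^+ 2.
  by move=> c1 d1; apply: exprn_gt0; rewrite modulus_gt0 mobius_den_neq0.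
rewrite lerD2l lerN2 ler_pdivrMr ?pos// mulrAC ler_pdivlMr ?pos ?hh//.
Qed.

(** With [d] the pseudo-hyperbolic distance, [|a - b| = d |1 - conj b a| <= d (1 - |b|^2 + |a -
    b|)], which is solved for [|a - b|]. *)
Lemma mobius_dist a b : modulus a < 1 -> modulus b < 1 ->
  modulus (a - b) <=
    modulus (mobius b a) / (1 - modulus (mobius b a)) * (1 - modulus b ^+ 2).
Proof.
move=> a1 b1; set d := modulus (mobius b a).
have d1 : d < 1 by exact: mobius_lt1.
have d0 : 0 <= d := modulus_ge0 _.
have E : modulus (a - b) = d * modulus (1 - conjc b * a).
  by rewrite -modulusM /mobius divfK// mobius_den_neq0.
have N : modulus (1 - conjc b * a) <= 1 - modulus b ^+ 2 + modulus (a - b).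
  have -> : 1 - conjc b * a = (1 - modulus b ^+ 2)%:C + conjc b * (b - a).
    rewrite sqr_modulus; apply/eqP; rewrite eq_complex.
    by case: (a) => ? ?; case: (b) => ? ? /=; apply/andP; split; apply/eqP; ring.
  apply: le_trans (modulusD _ _) _.
  have b2 : 0 <= 1 - modulus b ^+ 2 by rewrite subr_ge0 ltW// sqr_modulus_lt1.
  by rewrite modulus_real ger0_norm// lerD2l modulusM modulusJ modulusC
    ler_piMl ?modulus_ge0// ltW.
have d1' : 0 < 1 - d by rewrite subr_gt0.
rewrite mulrAC ler_pdivlMr// mulrBr mulr1 {1}E (mulrC _ d) -mulrBr.
by rewrite ler_wpM2l// lerBlDr.
Qed.

End SchwarzPick.

(** * Harnack, Julia and Julia-Caratheodory *)

Section JuliaCaratheodory.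
Variable R : realType.
Implicit Types (a b z w : R[i]).

Lemma Re_lt_modulus_reflect a b : 0 < Re a -> 0 < Re b ->
  modulus (a - b) < modulus (a + conjc b).
Proof.
move=> a0 b0; rewrite -(@ltr_pXn2r _ 2)// ?nnegrE ?modulus_ge0// !sqr_modulus.
rewrite -subr_gt0.
have -> : Re (a + conjc b) ^+ 2 + Im (a + conjc b) ^+ 2
    - (Re (a - b) ^+ 2 + Im (a - b) ^+ 2) = 4 * (Re a * Re b).
  by case: (a) => ? ?; case: (b) => ? ? /=; ring.
by rewrite !mulr_gt0.
Qed.

(** The Cayley transform [h] centred at [p = F b] maps into the disc and vanishes at [b].
    Schwarz-Pick gives [|F a - p| <= d |F a + conj p|], hence [|F a - p| (1 - d) <= 2 Re p];
    multiplying by [1 + d <= 2] produces [1 - d^2], which is explicit. *)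
Lemma harnack_pos (F : R[i] -> R[i]) :
  (forall z, modulus z < 1 -> differentiable F z) ->
  (forall z, modulus z < 1 -> 0 < Re (F z)) ->
  forall a b, modulus a < 1 -> modulus b < 1 ->
  modulus (F a - F b) <= 4 * Re (F b) *
    (modulus (1 - conjc b * a) ^+ 2 / ((1 - modulus b ^+ 2) * (1 - modulus a ^+ 2))).
Proof.
move=> dF hF a b a1 b1; set p := F b.
have p0 : 0 < Re p by exact: hF.
have den z : modulus z < 1 -> 0 < modulus (F z + conjc p).
  by move=> z1; apply: le_lt_trans (Re_lt_modulus_reflect (hF z z1) p0); exact: modulus_ge0.
pose h z := (F z - p) / (F z + conjc p).
have dh z : modulus z < 1 -> differentiable h z.
  move=> z1; apply: differentiableM; first by apply: differentiableB => //; exact: dF.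
  apply: differentiableV; last by rewrite -modulus_gt0 den.
  by apply: differentiableD => //; exact: dF.
have hh z : modulus z < 1 -> modulus (h z) < 1.
  move=> z1; rewrite /h modulusM modulusV ltr_pdivrMr ?den// mul1r.
  exact: Re_lt_modulus_reflect (hF z z1) p0.
have := schwarz_pick dh hh a1 b1.
have -> : h b = 0 by rewrite /h subrr mul0r.
have -> : mobius 0 (h a) = h a by rewrite /mobius conjc0 mul0r !subr0 divr1.
have := sqr_mobius b1 a1; set d := modulus (mobius b a) => dE.
have d0 : 0 <= d := modulus_ge0 _.
have d1 : d < 1 by exact: mobius_lt1.
rewrite /h modulusM modulusV ler_pdivrMr ?den//.
set Y := modulus (F a - p) => le1.
have le2 : modulus (F a + conjc p) <= Y + 2 * Re p.
  have -> : F a + conjc p = (F a - p) + (2 * Re p)%:C.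
    apply/eqP; rewrite eq_complex.
    by case: (F a) => ? ?; case: (p) => ? ? /=; apply/andP; split; apply/eqP; ring.
  apply: le_trans (modulusD _ _) _; rewrite modulus_real ger0_norm//.
  by rewrite mulr_ge0// ltW.
have le3 : Y * (1 - d) <= 2 * Re p.
  have := ler_wpM2l d0 le2; move: le1.
  have : d * Re p <= Re p by rewrite ler_piMl// ltW.
  by clear; lra.
set A := modulus _ ^+ 2; set B := (1 - _) * _.
have A0 : 0 < A by rewrite exprn_gt0// modulus_gt0 mobius_den_neq0.
have B0 : 0 < B by rewrite mulr_gt0// subr_gt0 sqr_modulus_lt1.
have BA : B / A = 1 - d ^+ 2 by rewrite dE subKr.
have Y0 : 0 <= Y := modulus_ge0 _.
have : Y * (B / A) <= 4 * Re p.
  rewrite BA; have := ler_wpM2l (addr_ge0 ler01 d0) le3.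
  have : 2 * Re p * d <= 2 * Re p * 1 by rewrite ler_wpM2l// ?mulr_ge0// ltW.
  by clear; lra.
by rewrite mulrA ler_pdivrMr// => ?; rewrite mulrA ler_pdivlMr.
Qed.

(** The strict case applied to [F + r] for small positive [r]. *)
Lemma harnack (F : R[i] -> R[i]) :
  (forall z, modulus z < 1 -> differentiable F z) ->
  (forall z, modulus z < 1 -> 0 <= Re (F z)) ->
  forall a b, modulus a < 1 -> modulus b < 1 ->
  modulus (F a - F b) <= 4 * Re (F b) *
    (modulus (1 - conjc b * a) ^+ 2 / ((1 - modulus b ^+ 2) * (1 - modulus a ^+ 2))).
Proof.
move=> dF hF a b a1 b1; set C := _ / _.
have C0 : 0 <= C.
  by rewrite divr_ge0 ?sqr_ge0// mulr_ge0// subr_ge0 ltW// sqr_modulus_lt1.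
apply/ler_addgt0Pr => e e0.
have C1 : 0 < 4 * C + 1 by rewrite ltr_wpDl// mulr_ge0.
pose r := e / (4 * C + 1); have r0 : 0 < r by rewrite divr_gt0.
have := @harnack_pos (fun z => F z + r%:C) _ _ a b a1 b1; rewrite -/C.
rewrite ReD /= opprD addrACA subrr addr0 => H.
apply: le_trans (H _ _) _.
- by move=> z z1; apply: differentiableD => //; exact: dF.
- by move=> z z1; rewrite ReD /= ltr_wpDl// hF.
- have -> : 4 * (Re (F b) + r) * C = 4 * Re (F b) * C + r * (4 * C) by ring.
  rewrite lerD2l; apply: le_trans (_ : r * (4 * C + 1) <= _).
    by rewrite ler_wpM2l ?(ltW r0)// lerDl.
  by rewrite /r divfK// gt_eqF.
Qed.

Lemma modulus_sub_conjM z w : modulus z < 1 ->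
  modulus (1 - conjc w * z - (1 - z)) <= modulus (1 - w).
Proof.
move=> z1; have -> : 1 - conjc w * z - (1 - z) = conjc (1 - w) * z.
  apply/eqP; rewrite eq_complex.
  by case: (z) => ? ?; case: (w) => ? ? /=; apply/andP; split; apply/eqP; ring.
by rewrite modulusM modulusJ ler_piMr ?modulus_ge0// ltW.
Qed.

(** Schwarz-Pick between [z] and base points [w] near 1: in the limit [1 - conj w z] becomes
    [1 - z], [1 - conj (g w) (g z)] becomes [1 - g z], and the boundary ratio at [w] is at most
    [1 + e]. *)
Lemma julia (g : R[i] -> R[i]) :
  (forall z, modulus z < 1 -> differentiable g z) ->
  (forall z, modulus z < 1 -> modulus (g z) < 1) ->
  (forall e : R, 0 < e -> exists w, [/\ modulus w < 1, modulus (1 - w) <= e,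
     modulus (1 - g w) <= e & 1 - modulus (g w) ^+ 2 <= (1 + e) * (1 - modulus w ^+ 2)]) ->
  forall z, modulus z < 1 ->
    (1 - modulus z ^+ 2) * modulus (1 - g z) ^+ 2
    <= (1 - modulus (g z) ^+ 2) * modulus (1 - z) ^+ 2.
Proof.
move=> dg hg approach z z1; have gz1 := hg z z1.
set A := 1 - modulus z ^+ 2; set B := 1 - modulus (g z) ^+ 2.
set p := modulus (1 - g z); set q := modulus (1 - z).
have A0 : 0 < A by rewrite subr_gt0 sqr_modulus_lt1.
have B0 : 0 < B by rewrite subr_gt0 sqr_modulus_lt1.
have A1 : A <= 1 by rewrite lerBlDr lerDl sqr_ge0.
have B1 : B <= 1 by rewrite lerBlDr lerDl sqr_ge0.
have q0 : 0 <= q := modulus_ge0 _.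
have p0 : 0 < p.
  rewrite modulus_gt0 subr_eq0; apply/eqP => E.
  by move: gz1; rewrite -E modulus1 ltxx.
have p2 : p <= 2.
  by apply: le_trans (modulusB _ _) _; rewrite modulus1; move: gz1; clear; lra.
have q2 : q <= 2.
  by apply: le_trans (modulusB _ _) _; rewrite modulus1; move: z1; clear; lra.
apply/ler_addgt0Pr => e e0.
(* The errors below add up to [4 h + 14 h]; [h <= p] keeps [p - h] nonnegative before squaring. *)
pose h := Num.min (Num.min 1 p) (e / 18).
have h0 : 0 < h by rewrite !lt_min ltr01 p0 divr_gt0.
have h1 : h <= 1 by rewrite !ge_min lexx.
have hp : h <= p by rewrite !ge_min lexx orbT.
have he : h <= e / 18 by rewrite !ge_min lexx orbT.
have [w [w1 wh gwh le]] := approach h h0.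
have := schwarz_pick_le dg hg z1 w1; rewrite -/A -/B.
set s := modulus (1 - conjc (g w) * g z); set t := modulus (1 - conjc w * z) => SP.
have W0 : 0 < 1 - modulus w ^+ 2 by rewrite subr_gt0 sqr_modulus_lt1.
have s0 : p - h <= s.
  have := modulus_sub_conjM (g w) gz1; have := ler_modulusB (1 - g z) (1 - conjc (g w) * g z).
  by rewrite modulusC -/s -/p; move: gwh; clear; lra.
have t0 : 0 <= t <= q + h.
  rewrite modulus_ge0 /=.
  have := modulus_sub_conjM w z1; have := ler_modulusB (1 - conjc w * z) (1 - z).
  by rewrite -/t -/q; move: wh; clear; lra.
have SP' : A * s ^+ 2 <= (1 + h) * B * t ^+ 2.
  rewrite -(ler_pM2l W0) [leLHS]mulrA; apply: le_trans SP _.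
  have -> : (1 - modulus w ^+ 2) * ((1 + h) * B * t ^+ 2)
      = (1 + h) * (1 - modulus w ^+ 2) * (B * t ^+ 2) by ring.
  by rewrite -mulrA ler_wpM2r// mulr_ge0 ?sqr_ge0// ltW.
have s2 : (p - h) ^+ 2 <= s ^+ 2.
  by rewrite lerXn2r ?nnegrE ?subr_ge0// (le_trans _ s0)// subr_ge0.
have t2 : t ^+ 2 <= (q + h) ^+ 2.
  by have /andP[? ?] := t0; rewrite lerXn2r ?nnegrE// addr_ge0// ltW.
have k1 : A * (p - h) ^+ 2 <= (1 + h) * B * (q + h) ^+ 2.
  apply: le_trans (_ : A * s ^+ 2 <= _); first by rewrite ler_wpM2l// ltW.
  apply: le_trans SP' _; rewrite ler_wpM2l// mulr_ge0 ?(ltW B0)//.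
  by rewrite addr_ge0// ltW.
have k2 : A * p ^+ 2 <= A * (p - h) ^+ 2 + 4 * h.
  have -> : A * p ^+ 2 = A * (p - h) ^+ 2 + A * (2 * p * h - h ^+ 2) by ring.
  rewrite lerD2l; apply: le_trans (_ : A * (4 * h) <= _).
    rewrite ler_wpM2l ?(ltW A0)//.
    have := ler_wpM2r (ltW h0) p2; have := sqr_ge0 h; clear; lra.
  by rewrite ler_piMl// mulr_ge0// ltW.
have k3 : (1 + h) * (q + h) ^+ 2 <= q ^+ 2 + 14 * h.
  have h0' := ltW h0.
  have hh : h ^+ 2 <= h by rewrite expr2 ler_piMl.
  have hq : q * h <= 2 * h by rewrite ler_wpM2r.
  have hq2 : q * (q * h) <= 2 * (2 * h) by rewrite ler_pM// mulr_ge0.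
  have hqh : q * h * h <= 2 * h * 1 by rewrite ler_pM// mulr_ge0.
  have h3 : h * h ^+ 2 <= 1 * h by rewrite ler_pM// sqr_ge0.
  have -> : (1 + h) * (q + h) ^+ 2
      = q ^+ 2 + 2 * (q * h) + h ^+ 2 + q * (q * h) + 2 * (q * h * h) + h * h ^+ 2 by ring.
  by clear -hh hq hq2 hqh h3; lra.
have k4 : (1 + h) * B * (q + h) ^+ 2 <= B * q ^+ 2 + 14 * h.
  rewrite mulrAC mulrC; apply: le_trans (ler_wpM2l (ltW B0) k3) _.
  by rewrite mulrDr lerD2l ler_piMl// mulr_ge0// ltW.
by clear -k1 k2 k4 he; lra.
Qed.

Lemma Re_cayley w :
  Re ((1 + w) / (1 - w)) = (1 - modulus w ^+ 2) / modulus (1 - w) ^+ 2.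
Proof. by rewrite !sqr_modulus; case: w => x y /=; ring. Qed.

Lemma julia_caratheodory (g : R[i] -> R[i]) :
  (forall z, modulus z < 1 -> differentiable g z) ->
  (forall z, modulus z < 1 -> modulus (g z) < 1) ->
  (forall z, modulus z < 1 -> (1 - modulus z ^+ 2) * modulus (1 - g z) ^+ 2
    <= (1 - modulus (g z) ^+ 2) * modulus (1 - z) ^+ 2) ->
  (forall d : R, 0 < d -> exists2 r : R, r < 1 & forall x : R, r < x < 1 ->
    (1 - d) * (1 - x) <= modulus (1 - g x%:C)) ->
  forall M e : R, 0 < M -> 0 < e -> exists2 d : R, 0 < d & forall z, modulus z < 1 ->
    modulus (1 - z) < d -> modulus (1 - z) <= M * (1 - modulus z) ->
    modulus (g z - z) <= e * modulus (1 - z).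
Proof.
move=> dg hg hj radial M e M0 e0.
have neq1 w : modulus w < 1 -> 1 - w != 0.
  by move=> w1; rewrite subr_eq0; apply: contraTneq w1 => <-; rewrite modulus1 ltxx.
have pos w : modulus w < 1 -> 0 < modulus (1 - w) ^+ 2.
  by move=> w1; rewrite exprn_gt0// modulus_gt0 neq1.
pose F z := (1 + g z) / (1 - g z) - (1 + z) / (1 - z).
have dF z : modulus z < 1 -> differentiable F z.
  move=> z1; have gz1 := hg z z1.
  apply: differentiableB.
    apply: differentiableM; first by apply: differentiableD => //; exact: dg.
    apply: differentiableV; last exact: neq1.
    by apply: differentiableB => //; exact: dg.
  apply: differentiableM; first by apply: differentiableD.
  apply: differentiableV; last exact: neq1.
  by apply: differentiableB.
have ReF z : Re (F z) = (1 - modulus (g z) ^+ 2) / modulus (1 - g z) ^+ 2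
    - (1 - modulus z ^+ 2) / modulus (1 - z) ^+ 2 by rewrite ReB !Re_cayley.
have hF z : modulus z < 1 -> 0 <= Re (F z).
  move=> z1; rewrite ReF subr_ge0 ler_pdivrMr ?pos// mulrAC ler_pdivlMr ?pos ?hg//.
  exact: hj.
(* The point is sought on the radius. There the Cayley transform of [g x] has real part at most
   [2 / |1 - g x|], hence at most [2 / ((1 - d) (1 - x))], to be compared with [(1 + x) / (1 - x)]
   for [x] itself. *)
have small eta : 0 < eta -> exists2 b, modulus b < 1 &
    Re (F b) <= eta * ((1 - modulus b ^+ 2) / modulus (1 - b) ^+ 2).
  move=> eta0; apply: contrapT => no.
  have e1 : 0 < 1 + eta by rewrite addr_gt0.
  (* Chosen so that [(1 + eta) (1 - d)^2 >= 1]. *)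
  pose d := eta / (4 * (1 + eta)).
  have d0 : 0 < d by rewrite divr_gt0// mulr_gt0.
  have [r r1 hr] := radial d d0.
  have d1 : d < 1.
    by rewrite ltr_pdivrMr ?mulr_gt0// mul1r; clear -eta0; lra.
  pose x := (1 + Num.max r (1 - d)) / 2.
  have mx1 : Num.max r (1 - d) < 1 by rewrite gt_max r1 ltrBlDr ltrDl.
  have xx : r < x /\ 1 - d < x.
    have : r <= Num.max r (1 - d) by rewrite le_max lexx.
    have : 1 - d <= Num.max r (1 - d) by rewrite le_max lexx orbT.
    by rewrite /x; clear -mx1 => *; split; lra.
  have x1 : x < 1 by rewrite /x; clear -mx1; lra.
  have x0 : 0 < x by apply: lt_trans xx.2; rewrite subr_gt0.
  have mx : modulus x%:C < 1 by rewrite modulus_real ger0_norm// ltW.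
  have h1x : modulus (1 - x%:C) = 1 - x.
    by rewrite -(rmorphB (real_complex R) 1 x) modulus_real ger0_norm// subr_ge0 ltW.
  apply: no; exists x%:C => //; rewrite leNgt; apply/negP.
  rewrite ReF h1x modulus_real ger0_norm ?(ltW x0)// => lt.
  have gx1 := hg _ mx.
  have := hr x; rewrite xx.1 x1 => /(_ isT).
  set p := modulus (1 - g x%:C) in lt *; set q := modulus (g x%:C) in lt gx1 *.
  have p0 : 0 < p by rewrite modulus_gt0 neq1.
  have qp : 1 - q <= p by have := ler_modulusB 1 (g x%:C); rewrite modulus1.
  have q0 : 0 <= q := modulus_ge0 _.
  have E : (1 - x ^+ 2) / (1 - x) ^+ 2 = (1 + x) / (1 - x).
    by field; clear -x1; lra.
  have le2 : (1 - q ^+ 2) / p ^+ 2 <= 2 / p.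
    rewrite ler_pdivrMr ?exprn_gt0//.
    have -> : 2 / p * p ^+ 2 = 2 * p by field; rewrite gt_eqF.
    have -> : 1 - q ^+ 2 = (1 + q) * (1 - q) by ring.
    have q1 : 0 <= 1 - q by rewrite subr_ge0 ltW.
    by rewrite ler_pM// ?addr_ge0//; clear -gx1; lra.
  rewrite E in lt.
  have lt2 : (1 + eta) * ((1 + x) / (1 - x)) < 2 / p by clear -lt le2; lra.
  have y0 : 0 < 1 - x by rewrite subr_gt0.
  rewrite ltr_pdivlMr// mulrA mulrAC ltr_pdivrMr// in lt2.
  move=> le; have : (1 + eta) * (1 + x) * ((1 - d) * (1 - x)) < 2 * (1 - x).
    by apply: le_lt_trans lt2; rewrite ler_wpM2l// mulr_ge0// ltW// addr_gt0.
  rewrite mulrA ltr_pM2r//; apply/negP; rewrite -leNgt.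
  have dE : d * (4 * (1 + eta)) = eta by rewrite /d divfK// gt_eqF// mulr_gt0.
  have xd := xx.2.
  have le3 : 2 * (1 - d) <= 1 + x by clear -xd d0; lra.
  have nd : 0 <= 1 - d by rewrite subr_ge0 ltW.
  have le4 : (1 + eta) * (2 * (1 - d)) * (1 - d) <= (1 + eta) * (1 + x) * (1 - d).
    by rewrite ler_wpM2r// ler_wpM2l// ltW.
  apply: le_trans le4.
  have : 0 <= (1 + eta) * d ^+ 2 by rewrite mulr_ge0 ?sqr_ge0// ltW.
  by clear -dE eta0 => *; nra.
(* Since [ee <= 1], the term [ee |g z - z|] at the end can be absorbed in the left side. *)
pose ee := Num.min e 1.
have ee0 : 0 < ee by rewrite lt_min e0 ltr01.
have ee1 : ee <= 1 by rewrite ge_min lexx orbT.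
have eee : ee <= e by rewrite ge_min lexx.
(* [128 = 4 . 4 . 8]: Harnack's factor, the bound [|1 - conj b z|^2 <= 4 s^2] valid once [z] is
   closer to 1 than [b], and the target [ee / 8]. *)
have eta0 : 0 < ee / (128 * M) by rewrite divr_gt0// mulr_gt0.
have [b b1 hb] := small _ eta0.
have Fb0 : 0 < 8 * (modulus (F b) + 1) by rewrite mulr_gt0// ltr_wpDl// modulus_ge0.
exists (Num.min (modulus (1 - b)) (ee / (8 * (modulus (F b) + 1)))).
  by rewrite lt_min modulus_gt0 neq1// divr_gt0.
move=> z z1; rewrite lt_min => /andP[zb zF] zM.
set q := modulus (1 - z) in zb zF zM *.
have q0 : 0 < q by rewrite modulus_gt0 neq1.
have H := harnack dF hF z1 b1.
set s := modulus (1 - b) in zb hb.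
have s0 : 0 < s by rewrite modulus_gt0 neq1.
have B0 : 0 < 1 - modulus b ^+ 2 by rewrite subr_gt0 sqr_modulus_lt1.
have Z0 : 0 < 1 - modulus z ^+ 2 by rewrite subr_gt0 sqr_modulus_lt1.
have bz : modulus (1 - conjc b * z) <= 2 * s.
  have := modulus_sub_conjM b z1; have := ler_modulusB (1 - conjc b * z) (1 - z).
  by rewrite -/q -/s; move: zb; clear; lra.
have bz2 : modulus (1 - conjc b * z) ^+ 2 <= 4 * s ^+ 2.
  have -> : 4 * s ^+ 2 = (2 * s) ^+ 2 by rewrite exprMn -natrX.
  by rewrite lerXn2r ?nnegrE ?modulus_ge0// mulr_ge0// ltW.
have H2 : modulus (F z - F b) <= ee / (8 * M) / (1 - modulus z ^+ 2).
  apply: le_trans H _.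
  apply: le_trans (_ : 4 * (ee / (128 * M) * ((1 - modulus b ^+ 2) / s ^+ 2)) *
     (4 * s ^+ 2 / ((1 - modulus b ^+ 2) * (1 - modulus z ^+ 2))) <= _).
    have i0 : 0 <= ((1 - modulus b ^+ 2) * (1 - modulus z ^+ 2))^-1.
      by rewrite invr_ge0 mulr_ge0// ltW.
    apply: ler_pM.
    - by rewrite mulr_ge0// hF.
    - by rewrite mulr_ge0// sqr_ge0.
    - by rewrite ler_wpM2l.
    - by rewrite ler_wpM2r.
  rewrite le_eqVlt; apply/orP; left; apply/eqP; field.
  by rewrite !gt_eqF.
have Mz : 1 - modulus z <= 1 - modulus z ^+ 2.
  by rewrite lerD2l lerN2 expr2 ler_piMl ?modulus_ge0// ltW.
have H3 : modulus (F z - F b) * q <= ee / 8.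
  have le : q <= M * (1 - modulus z ^+ 2).
    by apply: le_trans zM _; rewrite ler_wpM2l// ltW.
  apply: le_trans (ler_wpM2r (ltW q0) H2) _.
  apply: le_trans (_ : ee / (8 * M) / (1 - modulus z ^+ 2) * (M * (1 - modulus z ^+ 2)) <= _).
    by rewrite ler_wpM2l// !divr_ge0// ?(ltW Z0) ?(ltW ee0)// mulr_ge0// ltW.
  by rewrite le_eqVlt; apply/orP; left; apply/eqP; field; rewrite !gt_eqF.
have H4 : modulus (F b) * q <= ee / 8.
  move: zF; rewrite ltr_pdivlMr// => zF.
  by move: q0 zF; clear; lra.
have H5 : modulus (F z) * q <= ee / 4.
  have : modulus (F z) <= modulus (F z - F b) + modulus (F b).
    by rewrite -{1}(subrK (F b) (F z)); exact: modulusD.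
  move/(ler_wpM2r (ltW q0)); move: H3 H4; clear; lra.
have gz := neq1 _ (hg z z1).
have FE : F z * (1 - z) = 2 * (g z - z) / (1 - g z).
  by rewrite /F; field; rewrite gz neq1.
move: H5; rewrite -modulusM FE !modulusM modulusV.
have -> : modulus (2 : R[i]) = 2.
  by rewrite -[2 : R[i]](rmorph_nat (real_complex R) 2) modulus_real ger0_norm.
rewrite ler_pdivrMr ?modulus_gt0// => H5.
have : modulus (1 - g z) <= q + modulus (g z - z).
  have -> : 1 - g z = (1 - z) - (g z - z) by ring.
  exact: modulusB.
set y := modulus (g z - z) in H5 * => le.
have y0 : 0 <= y := modulus_ge0 _.
have : ee * modulus (1 - g z) <= ee * (q + y) by rewrite ler_wpM2l// ltW.
have : ee * y <= y by rewrite ler_piMl.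
have : ee * q <= e * q by rewrite ler_wpM2r// ltW.
by move: H5 y0 q0; clear; nra.
Qed.

End JuliaCaratheodory.

(** * Geometry of the ball and the axis map *)

Section Ball.
Variables (R : realType) (n : nat).
Local Notation C := (R[i]).
Local Notation V := 'rV[C]_n.+1.
Implicit Types (Z W : V) (z w : C).

Definition coord0 Z : C := Z ord0 ord0.

(** For [X = e1] this is the numerator in the definition of a special sequence, the denominator
    being [1 - |coord0 Z|^2]. *)
Definition tail_sqr Z : R := \sum_(j < n) modulus (Z ord0 (lift ord0 j)) ^+ 2.

Lemma sqr_enorm Z : enorm Z ^+ 2 = modulus (coord0 Z) ^+ 2 + tail_sqr Z.
Proof.
rewrite /enorm sqr_sqrtr; first by rewrite big_ord_recl.
by apply: sumr_ge0 => j _; rewrite sqr_ge0.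
Qed.

Lemma enorm_ge0 Z : 0 <= enorm Z.
Proof. exact: sqrtr_ge0. Qed.

Lemma tail_sqr_ge0 Z : 0 <= tail_sqr Z.
Proof. by apply: sumr_ge0 => j _; rewrite sqr_ge0. Qed.

Lemma unit_ballE Z : unit_ball Z <-> modulus (coord0 Z) ^+ 2 + tail_sqr Z < 1.
Proof. by rewrite /unit_ball /= -sqr_enorm expr_lt1// enorm_ge0. Qed.

Lemma coord0_lt1 Z : unit_ball Z -> modulus (coord0 Z) < 1.
Proof.
move/unit_ballE => h; rewrite -sqr_modulus_lt1; apply: le_lt_trans h.
by rewrite lerDl tail_sqr_ge0.
Qed.

Lemma coord0_le_enorm Z : modulus (coord0 Z) <= enorm Z.
Proof.
rewrite -(@ler_pXn2r _ 2)// ?nnegrE ?modulus_ge0 ?enorm_ge0// sqr_enorm lerDl.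
exact: tail_sqr_ge0.
Qed.

Lemma coord0D Z W : coord0 (Z + W) = coord0 Z + coord0 W.
Proof. by rewrite /coord0 mxE. Qed.

Lemma coord0Z z Z : coord0 (z *: Z) = z * coord0 Z.
Proof. by rewrite /coord0 mxE. Qed.

Lemma coord0_e1 : coord0 (e1 R n) = 1.
Proof. by rewrite /coord0 mxE !eqxx. Qed.

Lemma e1_tail j : e1 R n ord0 (lift ord0 j) = 0.
Proof. by rewrite mxE eqxx. Qed.

Lemma tail_sqrDe1 z Z : tail_sqr (z *: e1 R n + Z) = tail_sqr Z.
Proof. by apply: eq_bigr => j _; rewrite 2!mxE e1_tail mulr0 add0r. Qed.

Lemma tail_sqrZ z Z : tail_sqr (z *: Z) = modulus z ^+ 2 * tail_sqr Z.
Proof. by rewrite /tail_sqr mulr_sumr; apply: eq_bigr => j _; rewrite mxE modulusM exprMn. Qed.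

Lemma tail_sqr0 : tail_sqr 0 = 0.
Proof. by apply: big1 => j _; rewrite mxE modulus0 expr0n. Qed.

Lemma sqr_enormZe1 z : enorm (z *: e1 R n) ^+ 2 = modulus z ^+ 2.
Proof.
by rewrite sqr_enorm coord0Z coord0_e1 mulr1 -[_ *: _]addr0 tail_sqrDe1 tail_sqr0 addr0.
Qed.

Lemma unit_ballZe1 z : modulus z < 1 -> unit_ball (z *: e1 R n).
Proof.
by rewrite -sqr_modulus_lt1 -sqr_enormZe1 expr_lt1// enorm_ge0.
Qed.

Lemma hdot_e1 Z : hdot Z (e1 R n) = coord0 Z.
Proof.
rewrite /hdot big_ord_recl big1 => [|j _]; last by rewrite e1_tail conjc0 mulr0.
by rewrite -/(coord0 (e1 R n)) coord0_e1 conjc1 mulr1 addr0.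
Qed.

Lemma coord0_sub_axis Z : coord0 (Z - coord0 Z *: e1 R n) = 0.
Proof. by rewrite -scaleNr coord0D coord0Z coord0_e1 mulr1 subrr. Qed.

Lemma tail_sqr_sub Z : tail_sqr (Z - coord0 Z *: e1 R n) = tail_sqr Z.
Proof. by rewrite -scaleNr addrC tail_sqrDe1. Qed.

Lemma tail_sqr_eq0 Z : tail_sqr Z = 0 -> Z = coord0 Z *: e1 R n.
Proof.
move=> /eqP; rewrite psumr_eq0 => [/allP h|j _]; last exact: sqr_ge0.
apply/rowP => j; rewrite mxE; case: (unliftP ord0 j) => [k ->|->].
  rewrite e1_tail mulr0; apply/eqP; rewrite -modulus_eq0 -sqrf_eq0.
  exact: h (mem_index_enum k).
by rewrite -[e1 R n _ _]/(coord0 (e1 R n)) coord0_e1 mulr1.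
Qed.

Lemma hdot_coord0_tail Z W :
  modulus (hdot Z W - coord0 Z * conjc (coord0 W)) <= (tail_sqr Z + tail_sqr W) / 2.
Proof.
rewrite /hdot big_ord_recl addrAC subrr add0r -big_split /= mulr_suml.
elim/big_ind2: _ => [|x a y b ha hb|j _]; first by rewrite modulus0.
  by apply: le_trans (modulusD _ _) _; exact: lerD.
rewrite modulusM modulusJ.
set x := modulus _; set y := modulus _.
by have := sqr_ge0 (x - y); clear; nra.
Qed.

(** Everything is compared with [rz]: the quotient in the distance is at least
    [(1 - eta)^2 (1 - 6 eta) / (1 + 5 eta)^2], and [18 = 2 + 6 + 10] collects the first-order
    terms. *)
Lemma pseudo_hyp_dist_le Z W (eta : R) : 0 < eta <= 1 / 8 ->
  unit_ball Z -> unit_ball W ->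
  tail_sqr Z <= eta * (1 - modulus (coord0 Z) ^+ 2) ->
  tail_sqr W <= eta * (1 - modulus (coord0 W) ^+ 2) ->
  modulus (coord0 Z - coord0 W) <= 3 * eta * (1 - modulus (coord0 Z) ^+ 2) ->
  pseudo_hyp_dist Z W <= Num.sqrt (18 * eta).
Proof.
move=> /andP[eta0 eta8] BZ BW tZ tW zw.
have z1 := coord0_lt1 BZ; have w1 := coord0_lt1 BW.
have tZ0 := tail_sqr_ge0 Z; have tW0 := tail_sqr_ge0 W.
rewrite /pseudo_hyp_dist !sqr_enorm ler_wsqrtr//.
have dist := hdot_coord0_tail Z W.
move: dist tZ tW zw z1 w1 tZ0 tW0.
set z := coord0 Z; set w := coord0 W; set tz := tail_sqr Z; set tw := tail_sqr W.
set d := modulus (1 - hdot Z W) => dist tZ tW zw z1 w1 tZ0 tW0.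
set rz := 1 - modulus z ^+ 2 in tZ zw; set rw := 1 - modulus w ^+ 2 in tW.
have rz0 : 0 < rz by rewrite subr_gt0 sqr_modulus_lt1.
have rw0 : 0 < rw by rewrite subr_gt0 sqr_modulus_lt1.
have rwz : `|rw - rz| <= 6 * eta * rz.
  have -> : rw - rz = (modulus z - modulus w) * (modulus z + modulus w).
    by rewrite /rw /rz; ring.
  rewrite normrM; have -> : 6 * eta * rz = 3 * eta * rz * 2 by ring.
  apply: ler_pM => //.
    apply: le_trans zw; rewrite ler_norml; have := ler_modulusB z w.
    by have := ler_modulusB w z; rewrite (modulusC w); clear; lra.
  by rewrite ger0_norm ?addr_ge0 ?modulus_ge0//; clear -z1 w1; lra.
have er : eta * rz <= rz / 8 by move: (ler_wpM2r (ltW rz0) eta8); clear; lra.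
have [rw1 rw2] : rw <= (1 + 6 * eta) * rz /\ (1 - 6 * eta) * rz <= rw.
  by move: rwz; rewrite ler_norml => /andP[]; clear; lra.
have tw2 : tw <= 2 * eta * rz.
  apply: le_trans tW _; have : eta * rw <= eta * (2 * rz).
    by rewrite ler_wpM2l ?(ltW eta0)//; move: rw1 er; clear -rz0; lra.
  by clear; lra.
have near : modulus (1 - z * conjc w - rz%:C) <= 3 * eta * rz.
  have -> : 1 - z * conjc w - rz%:C = z * conjc (z - w).
    rewrite /rz sqr_modulus; apply/eqP; rewrite eq_complex.
    by case: (z) => ? ?; case: (w) => ? ? /=; apply/andP; split; apply/eqP; ring.
  apply: le_trans zw; rewrite modulusM modulusJ ler_piMl ?modulus_ge0//.
  exact: ltW.
have near2 : modulus (1 - hdot Z W - rz%:C) <= 5 * eta * rz.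
  have -> : 1 - hdot Z W - rz%:C = (1 - z * conjc w - rz%:C) - (hdot Z W - z * conjc w).
    by ring.
  apply: le_trans (modulusB _ _) _; move: near dist tZ tw2.
  have : 0 <= eta * rz by rewrite mulr_ge0// ltW.
  by clear; lra.
have rzC : modulus rz%:C = rz by rewrite modulus_real gtr0_norm.
have d1 : d <= (1 + 5 * eta) * rz.
  have := ler_modulusB (1 - hdot Z W) rz%:C; rewrite rzC -/d.
  by move: near2; clear; lra.
have d0 : 0 < d.
  have := ler_modulusB rz%:C (1 - hdot Z W); rewrite rzC -/d modulusC.
  by move: near2 er rz0; clear; lra.
have -> : 1 - (modulus z ^+ 2 + tz) = rz - tz by rewrite /rz; ring.
have -> : 1 - (modulus w ^+ 2 + tw) = rw - tw by rewrite /rw; ring.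
rewrite lerBlDr -lerBlDl ler_pdivlMr ?exprn_gt0//.
have num : (1 - eta) * rz * ((1 - eta) * ((1 - 6 * eta) * rz)) <= (rz - tz) * (rw - tw).
  have e1' : 0 <= 1 - eta by move: eta8; clear; lra.
  have e6' : 0 <= 1 - 6 * eta by move: eta8; clear; lra.
  apply: ler_pM.
  - by rewrite mulr_ge0// ltW.
  - by rewrite !mulr_ge0// ltW.
  - by move: tZ; clear; lra.
  - apply: le_trans (_ : (1 - eta) * rw <= _); first by rewrite ler_wpM2l.
    by move: tW; clear; lra.
apply: le_trans num.
(* For larger [eta] the factor is not positive and cannot multiply the upper bound on [d]; the
   inequality then holds by sign. *)
have [neg|pos] := leP (1 - 18 * eta) 0.
  apply: le_trans (_ : 0 <= _); first by rewrite mulr_le0_ge0// sqr_ge0.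
  rewrite !mulr_ge0 ?(ltW rz0)//; move: eta8; clear; lra.
apply: le_trans (_ : (1 - 18 * eta) * ((1 + 5 * eta) * rz) ^+ 2 <= _).
  rewrite ler_wpM2l ?(ltW pos)// lerXn2r ?nnegrE ?(ltW d0)//.
  by apply: mulr_ge0 (ltW rz0); move: eta0; clear; lra.
have -> : (1 - eta) * rz * ((1 - eta) * ((1 - 6 * eta) * rz))
  = (1 - 18 * eta) * ((1 + 5 * eta) * rz) ^+ 2 + rz ^+ 2 * (eta ^+ 2 * (168 + 444 * eta)).
  by ring.
have q0 : 0 <= 168 + 444 * eta by move: eta0; clear; lra.
by rewrite lerDl; apply: mulr_ge0; [|apply: mulr_ge0 q0]; exact: sqr_ge0.
Qed.

(** * Restriction of a self-map of the ball to complex lines *)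

Section Slice.
Variable f : V -> V.
Hypothesis ff : forall Z, unit_ball Z -> unit_ball (f Z).
Hypothesis df : forall Z : V, unit_ball Z -> differentiable f Z.

Lemma differentiable_slice Z W z : unit_ball (Z + z *: W) ->
  differentiable (fun w => coord0 (f (Z + w *: W))) z.
Proof.
move=> B.
apply: (@differentiable_comp _ _ _ _ (fun w => f (Z + w *: W)) (fun N => N ord0 ord0));
  last exact: differentiable_coord.
apply: (@differentiable_comp _ _ _ _ (fun w => Z + w *: W) f); last exact: df.
by apply: differentiableD => //; exact: differentiableZl.
Qed.

Definition axis_map z : C := coord0 (f (z *: e1 R n)).

Lemma differentiable_axis_map z : modulus z < 1 -> differentiable axis_map z.
Proof.
move=> z1; have -> : axis_map = (fun w => coord0 (f (0 + w *: e1 R n))).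
  by apply/funext => w; rewrite add0r.
by apply: differentiable_slice; rewrite add0r; exact: unit_ballZe1.
Qed.

Lemma axis_map_lt1 z : modulus z < 1 -> modulus (axis_map z) < 1.
Proof. by move=> z1; apply: coord0_lt1; apply: ff; exact: unit_ballZe1. Qed.

(* One-variable Schwarz-Pick on the disc through [Z] and its projection
   [coord0 Z *: e1] on which the first coordinate is constant. *)
Lemma slice_mobius Z : unit_ball Z ->
  modulus (mobius (coord0 (f Z)) (axis_map (coord0 Z)))
    <= Num.sqrt (tail_sqr Z / (1 - modulus (coord0 Z) ^+ 2)).
Proof.
move=> BZ; have z1 := coord0_lt1 BZ.
set z := coord0 Z; set t := _ / _.
have r0 : 0 < 1 - modulus z ^+ 2 by rewrite subr_gt0 sqr_modulus_lt1.
have [tZ0|tZ0] := eqVneq (tail_sqr Z) 0.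
  by rewrite /axis_map -tail_sqr_eq0// /mobius subrr mul0r modulus0 sqrtr_ge0.
have tZ : 0 < tail_sqr Z by rewrite lt_neqAle eq_sym tZ0 tail_sqr_ge0.
have t0 : 0 < t by rewrite divr_gt0.
have t1 : t < 1.
  by rewrite ltr_pdivrMr// mul1r ltrBrDl; exact/unit_ballE.
have s0 : 0 < Num.sqrt t by rewrite sqrtr_gt0.
have s1 : Num.sqrt t < 1 by rewrite -sqrtr1 ltr_sqrt.
(* Scaled so that the unit disc of parameters stays in the ball. The projection of [Z] has parameter
   0 and [Z] has parameter [Num.sqrt t], so their distance on this disc is [Num.sqrt t]. *)
pose W := (Num.sqrt t)^-1%:C *: (Z - z *: e1 R n).
have BW w : modulus w < 1 -> unit_ball (z *: e1 R n + w *: W).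
  move=> w1; apply/unit_ballE; rewrite coord0D !coord0Z coord0_e1 mulr1 coord0_sub_axis.
  rewrite !mulr0 addr0 tail_sqrDe1 !tail_sqrZ tail_sqr_sub modulus_real.
  rewrite ger0_norm ?invr_ge0 ?(ltW s0)// exprVn sqr_sqrtr ?(ltW t0)//.
  have -> : t^-1 * tail_sqr Z = 1 - modulus z ^+ 2.
    by rewrite /t; field; rewrite tZ0 gt_eqF.
  by rewrite -ltrBrDl gtr_pMl// sqr_modulus_lt1.
have ms : modulus (Num.sqrt t)%:C = Num.sqrt t by rewrite modulus_real ger0_norm// ltW.
have s1' : modulus (Num.sqrt t)%:C < 1 by rewrite ms.
have m0 : modulus (0 : C) < 1 by rewrite modulus0.
pose h w := coord0 (f (z *: e1 R n + w *: W)).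
have dh x : modulus x < 1 -> differentiable h x.
  by move=> x1; apply: differentiable_slice; exact: BW.
have hh x : modulus x < 1 -> modulus (h x) < 1.
  by move=> x1; apply: coord0_lt1; apply: ff; exact: BW.
have := schwarz_pick dh hh m0 s1'; rewrite /h.
rewrite scale0r addr0 -/(axis_map z).
have -> : z *: e1 R n + (Num.sqrt t)%:C *: W = Z.
  rewrite /W scalerA -(rmorphM (real_complex R)) divff ?gt_eqF// scale1r.
  by rewrite addrC subrK.
move/le_trans; apply.
by rewrite /mobius mulr0 subr0 divr1 sub0r modulusN ms.
Qed.

End Slice.
End Ball.

(** * Restricted orbits *)

Section Main.
Variables (R : realType) (n : nat).
Local Notation V := 'rV[R[i]]_n.+1.
Variable f : V -> V.
Hypothesis ff : forall Z, unit_ball Z -> unit_ball (f Z).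
Hypothesis df : forall Z : V, unit_ball Z -> differentiable f Z.

(** On the radius, [|1 - g x| >= 1 - |g x| >= 1 - enorm (f (x e1))], and the lower limit bounds the
    last quantity from below by [(1 - d) (1 - x)]. *)
Lemma axis_map_radial : multiplier f (e1 R n) = 1%:E ->
  forall d : R, 0 < d -> exists2 r : R, r < 1 & forall x : R, r < x < 1 ->
    (1 - d) * (1 - x) <= modulus (1 - axis_map f x%:C).
Proof.
move=> mf d d0.
have : ((1 - d)%:E < multiplier f (e1 R n))%E by rewrite mf lte_fin ltrBlDr ltrDl.
rewrite /multiplier limf_einfE => /ereal_sup_gt[_ [U hU <-] dU].
have cont : {for 1, continuous (fun z : R[i] => z *: e1 R n)}.
  by apply: differentiable_continuous; exact: differentiableZl.
have hU' : nbhs (1 *: e1 R n : V) (fun Z => unit_ball Z -> U Z) by rewrite scale1r.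
have /nbhs_ballP[e /= e0 he] := cont _ hU'.
have [r Er] : exists r, e = r%:C.
  by case: e e0 {he} => a b; rewrite ltcE /= => /andP[/eqP -> _]; exists a.
rewrite {e}Er ltcR in e0 he.
exists (Num.max 0 (1 - r)); first by rewrite gt_max ltr01 ltrBlDr ltrDl.
move=> x; rewrite gt_max => /andP[/andP[x0 xr] x1].
have mx : modulus x%:C = x by rewrite modulus_real gtr0_norm.
have mx1 : modulus x%:C < 1 by rewrite mx.
have ux : U (x%:C *: e1 R n).
  apply: he; last exact: unit_ballZe1.
  rewrite /ball/= normC_modulus ltcR -(rmorphB (real_complex R) 1 x) modulus_real.
  rewrite gtr0_norm ?subr_gt0//; move: xr; lra.
have := lt_le_trans dU (ereal_inf_lbound (imageP _ ux)).
have -> : enorm (x%:C *: e1 R n) = x.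
  apply/eqP; rewrite -(@eqrXn2 _ 2) ?enorm_ge0 ?(ltW x0)//.
  by rewrite sqr_enormZe1 mx.
rewrite lte_fin ltr_pdivlMr ?subr_gt0// => /ltW/le_trans; apply.
have := coord0_le_enorm (f (x%:C *: e1 R n)); rewrite -/(axis_map f x%:C).
have := ler_modulusB 1 (axis_map f x%:C); rewrite modulus1.
by lra.
Qed.

Variable Z : nat -> V.
Hypothesis ZS : forall k, Z k.+1 = f (Z k).
Hypothesis BZ : forall k, unit_ball (Z k).

Let z k := coord0 (Z k).
Let rho k := 1 - modulus (z k) ^+ 2.
Let g := axis_map f.

Hypothesis z_lim : forall e : R, 0 < e ->
  exists N, forall k, (N <= k)%N -> modulus (1 - z k) < e.
Hypothesis t_lim : forall e : R, 0 < e ->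
  exists N, forall k, (N <= k)%N -> tail_sqr (Z k) <= e * rho k.
Variable M : R.
Hypothesis M0 : 0 < M.
Hypothesis z_stolz :
  exists N, forall k, (N <= k)%N -> modulus (1 - z k) <= M * (1 - modulus (z k)).
Hypothesis mult1 : multiplier f (e1 R n) = 1%:E.

Let z1 k : modulus (z k) < 1. Proof. exact: coord0_lt1. Qed.
Let g1 k : modulus (g (z k)) < 1. Proof. exact: axis_map_lt1. Qed.
Let rho0 k : 0 < rho k. Proof. by rewrite subr_gt0 sqr_modulus_lt1. Qed.

Let rho_le w w' : modulus w < 1 -> modulus w' < 1 ->
  1 - modulus w ^+ 2 <= 1 - modulus w' ^+ 2 + 2 * modulus (w' - w) :> R.
Proof.
move=> w1 w1'.
have -> : 1 - modulus w ^+ 2 = 1 - modulus w' ^+ 2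
   + (modulus w' + modulus w) * (modulus w' - modulus w) by ring.
rewrite lerD2l; have [neg|pos] := leP (modulus w' - modulus w) 0.
  apply: le_trans (_ : 0 <= _).
    by rewrite mulr_ge0_le0// addr_ge0// modulus_ge0.
  by rewrite mulr_ge0// modulus_ge0.
apply: ler_pM (ltW pos) _ (ler_modulusB _ _).
  by rewrite addr_ge0// modulus_ge0.
by move: w1 w1'; lra.
Qed.

(** Specialness with constant [(eta / 2)^2] makes the slice distance [d] at most [eta / 2 <= 1/2],
    so [d / (1 - d) <= eta]. The disc is centred at [z k.+1], hence the weight [rho k.+1]. *)
Lemma axis_map_near_next (eta : R) : 0 < eta <= 1 ->
  exists N, forall k, (N <= k)%N -> modulus (g (z k) - z k.+1) <= eta * rho k.+1.
Proof.
move=> /andP[eta0 eta1].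
have e0 : 0 < (eta / 2) ^+ 2 by rewrite exprn_gt0// divr_gt0.
have [N hN] := t_lim e0; exists N => k Nk.
have zE : z k.+1 = coord0 (f (Z k)) by rewrite /z ZS.
have fz1 := z1 k.+1; rewrite zE in fz1.
apply: le_trans (mobius_dist (g1 k) (z1 k.+1)) _.
rewrite -/(rho k.+1) ler_wpM2r ?(ltW (rho0 _))// zE.
have := slice_mobius ff df (BZ k); rewrite -/(z k) -/(rho k) -/g.
set d := modulus _ => ds.
have {}ds : d <= eta / 2.
  apply: le_trans ds _; rewrite -(@ger0_norm _ (eta / 2)) ?divr_ge0 ?(ltW eta0)//.
  by rewrite -sqrtr_sqr ler_wsqrtr// ler_pdivrMr// hN.
rewrite ler_pdivrMr; last by move: ds eta1; lra.
have : eta * d <= eta / 2.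
  by rewrite ler_wpM2l ?(ltW eta0)//; move: ds eta1; lra.
by move: ds; lra.
Qed.

(** Otherwise [rho] would increase from [N] on, although [rho k <= 2 |1 - z k|] tends to 0. *)
Lemma rho_frequently_decreases N : exists2 k, (N <= k)%N & rho k.+1 <= rho k.
Proof.
apply: contrapT => no.
have inc k : (N <= k)%N -> rho k < rho k.+1.
  by move=> Nk; rewrite ltNge; apply/negP => le; apply: no; exists k.
have mono j : rho N <= rho (N + j)%N.
  elim: j => [|j IH]; rewrite ?addn0// addnS; apply: le_trans IH (ltW (inc _ _)).
  exact: leq_addr.
have e0 : 0 < rho N / 2 by rewrite divr_gt0.
have [N' hN'] := z_lim e0.
have := hN' (N + N')%N (leq_addl _ _); have := mono N'; have := z1 (N + N')%N.
have := ler_modulusB 1 (z (N + N')%N); rewrite modulus1.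
have : rho (N + N')%N = (1 - modulus (z (N + N')%N)) * (1 + modulus (z (N + N')%N)).
  by rewrite /rho; ring.
have := modulus_ge0 (z (N + N')%N).
by move: (modulus _) (modulus _) (rho _) (rho _); move=> *; nra.
Qed.

(** Base points are those [z k] with [rho k.+1 <= rho k]: there [1 - |g (z k)|^2 <= (1 + 2 eta) rho
    k.+1 <= (1 + e) rho k]. *)
Lemma axis_map_julia w : modulus w < 1 ->
  (1 - modulus w ^+ 2) * modulus (1 - g w) ^+ 2
  <= (1 - modulus (g w) ^+ 2) * modulus (1 - w) ^+ 2.
Proof.
apply: julia => [x|x|e e0]; [exact: differentiable_axis_map|exact: axis_map_lt1|].
pose eta := Num.min 1 e / 4.
have m0 : 0 < Num.min 1 e by rewrite lt_min ltr01.
have eta0 : 0 < eta by rewrite divr_gt0.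
have ete : eta <= e / 4 by rewrite ler_wpM2r// ge_min lexx orbT.
have et1 : eta <= 1.
  have : Num.min 1 e <= 1 by rewrite ge_min lexx.
  by rewrite /eta; lra.
have [N1 h1] := axis_map_near_next (ltac:(by rewrite eta0) : 0 < eta <= 1).
have e20 : 0 < e / 2 by rewrite divr_gt0.
have [N2 h2] := z_lim e20.
have [k Nk le] := rho_frequently_decreases (maxn N1 N2).
move: Nk; rewrite geq_max => /andP[Nk1 Nk2].
have {h1}h1 := h1 k Nk1.
have h2' := h2 k.+1 (leqW Nk2); have {h2}h2 := h2 k Nk2.
have r0 := rho0 k.+1.
have r1 : rho k.+1 <= 1 by rewrite /rho lerBlDr lerDl sqr_ge0.
exists (z k); split=> //.
- by move: h2 e0; lra.
- have -> : 1 - g (z k) = (1 - z k.+1) - (g (z k) - z k.+1) by ring.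
  apply: le_trans (modulusB _ _) _.
  have : eta * rho k.+1 <= eta by rewrite ler_piMr// ltW.
  by move: h1 h2' ete e0; lra.
- have := rho_le (g1 k) (z1 k.+1); rewrite -/(rho k.+1) -/(rho k) modulusC => h3.
  apply: le_trans (_ : (1 + e) * rho k.+1 <= _); last first.
    by rewrite ler_wpM2l// addr_ge0// ltW.
  have : eta * rho k.+1 <= e / 4 * rho k.+1 by rewrite ler_wpM2r// ltW.
  have : 0 <= e * rho k.+1 by rewrite mulr_ge0// ltW.
  by move: h3 h1; lra.
Qed.

Lemma axis_map_near_id (eta : R) : 0 < eta ->
  exists N, forall k, (N <= k)%N -> modulus (g (z k) - z k) <= eta * rho k.
Proof.
(* The Stolz condition turns [|1 - z k|] into at most [M rho k], which cancels this [M]. *)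
move=> eta0; have e0 : 0 < eta / M by rewrite divr_gt0.
have [d d0 H] := julia_caratheodory (@differentiable_axis_map _ _ _ df)
  (@axis_map_lt1 _ _ _ ff) axis_map_julia (axis_map_radial mult1) M0 e0.
have [N1 h1] := z_lim d0; have [N2 h2] := z_stolz.
exists (maxn N1 N2) => k; rewrite geq_max => /andP[Nk1 Nk2].
apply: le_trans (H _ (z1 k) (h1 k Nk1) (h2 k Nk2)) _.
apply: le_trans (ler_wpM2l (ltW e0) (h2 k Nk2)) _.
rewrite mulrA divfK ?gt_eqF// ler_wpM2l ?(ltW eta0)//.
by rewrite /rho lerD2l lerN2 expr2 ler_piMl ?modulus_ge0// ltW.
Qed.

Lemma orbit_step (eta : R) : 0 < eta <= 1 / 8 ->
  exists N, forall k, (N <= k)%N ->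
    pseudo_hyp_dist (Z k) (Z k.+1) <= Num.sqrt (18 * eta).
Proof.
move=> eta8; have /andP[eta0 eta8'] := eta8.
have eta1 : 0 < eta <= 1 by rewrite eta0; move: eta8'; lra.
have [N1 h1] := axis_map_near_next eta1.
have [N2 h2] := axis_map_near_id eta0.
have [N3 h3] := t_lim eta0.
exists (maxn (maxn N1 N2) N3) => k; rewrite !geq_max => /andP[/andP[k1 k2] k3].
apply: (pseudo_hyp_dist_le eta8) => //; [exact: h3|exact/h3/leqW|].
rewrite -/(z k) -/(z k.+1) -/(rho k).
have := h1 k k1; have := h2 k k2; have := rho_le (z1 k.+1) (z1 k).
rewrite -/(rho k) -/(rho k.+1).
have : modulus (z k - z k.+1) <= modulus (g (z k) - z k.+1) + modulus (g (z k) - z k).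
  have -> : z k - z k.+1 = (g (z k) - z k.+1) - (g (z k) - z k) by ring.
  exact: modulusB.
set x := modulus (z k - _); move=> h4 h5 h6 h7.
have x0 : 0 <= x := modulus_ge0 _.
(* So [x <= 2 eta rho k + 2 eta x] with [2 eta <= 1/4], whence [x <= 3 eta rho k]. *)
have l1 : eta * rho k.+1 <= eta * (rho k + 2 * x) by rewrite ler_wpM2l// ltW.
have l2 : eta * x <= 1 / 8 * x by rewrite ler_wpM2r.
have l3 : 0 <= eta * rho k by rewrite mulr_ge0// ltW.
by move: h4 h6 h7 l1 l2 l3; lra.
Qed.

End Main.

Theorem theorem3p7 (R : realType) (n : nat)
    (f : 'rV[R[i]]_n.+1 -> 'rV[R[i]]_n.+1)
    (hf : parabolic_with_dw_point f (e1 R n))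
    (Z0 : 'rV[R[i]]_n.+1) (hZ0 : unit_ball Z0)
    (hres : restricted_seq (e1 R n) (fun k : nat => iter k.+1 f Z0)) :
  zero_step (fun k : nat => iter k.+1 f Z0).
Proof.
have [[ff df] _ _ mf] := hf.
have [[_ BZ _ tZ] hz [M M1 hM]] := hres.
set Z := fun k => iter k.+1 f Z0 in BZ tZ hz hM *.
have ZS k : Z k.+1 = f (Z k) by [].
have z_lim (e : R) : 0 < e ->
    exists N, forall k, (N <= k)%N -> modulus (1 - coord0 (Z k)) < e.
  move=> e0; have e0' : 0 < e%:C :> R[i] by rewrite ltcR.
  move/cvgrPdist_lt : hz => /(_ _ e0')[N _ hN]; exists N => k /hN /=.
  by rewrite hdot_e1 normC_modulus ltcR.
have t_lim (e : R) : 0 < e -> exists N, forall k, (N <= k)%N ->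
    tail_sqr (Z k) <= e * (1 - modulus (coord0 (Z k)) ^+ 2).
  move=> e0; move/cvgrPdist_lt : tZ => /(_ _ e0)[N _ hN]; exists N => k /hN /=.
  rewrite hdot_e1 sqr_enorm coord0_sub_axis tail_sqr_sub sqr_enormZe1.
  rewrite modulus0 expr0n /= !add0r normrN => /(le_lt_trans (ler_norm _)) lt.
  rewrite -ler_pdivrMr ?subr_gt0 ?sqr_modulus_lt1; [exact: ltW|exact: coord0_lt1 (BZ k)].
have z_stolz : exists N, forall k, (N <= k)%N ->
    modulus (1 - coord0 (Z k)) <= M * (1 - modulus (coord0 (Z k))).
  have [N _ hN] := hM; exists N => k /hN /=.
  by rewrite hdot_e1 => /ltW.
have M0 : 0 < M by exact: lt_trans M1.
apply/cvgrPdist_lt => e e0.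
(* With this choice [18 eta <= e^2 / 2 < e^2]. *)
pose eta := Num.min (1 / 8) (e ^+ 2 / 36).
have eta8 : 0 < eta <= 1 / 8.
  by rewrite ge_min lexx lt_min !divr_gt0// exprn_gt0.
have [N hN] := orbit_step ff df ZS BZ z_lim t_lim M0 z_stolz mf eta8.
exists N => // k /hN /= le.
rewrite sub0r normrN ger0_norm ?sqrtr_ge0//.
apply: le_lt_trans le _; rewrite -(ger0_norm (ltW e0)) -sqrtr_sqr.
rewrite ltr_sqrt ?exprn_gt0//.
have : eta <= e ^+ 2 / 36 by rewrite ge_min lexx orbT.
have : 0 < e ^+ 2 by rewrite exprn_gt0.
by lra.
Qed.
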